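(* There do not exist formulas of $L_{\omega_1\omega}$ in the language $\{<\}$ of linear orderings which, for every directed graph $G$, define an interpretation of $G$ in the linear ordering $L(G)$. That is, there is no fixed triple of $L_{\omega_1\omega}$-definitions of a set $D\subseteq L(G)^{<\omega}$ and relations $\sim$ and $E^*$ on $D$ such that, for every directed graph $G$, when evaluated in $L(G)$ they yield $D$, an equivalence relation $\sim$ on $D$ compatible with $E^*$, and $(D,E^* )/_{\sim}\cong G$.
   Context: A directed graph is a structure $G=(V,E)$ with $E$ a binary relation and universe $V\subseteq\omega$. Fix an effective partition $(A_n)_{n\in\omega}$ of $\mathbb{Q}$ into pairwise disjoint sets, each dense in $\mathbb{Q}$. Fix an effective list $(t_m)_{1\le m<\omega}$ of all atomic (complete quantifier-free) types in the language $\{E\}$ of tuples of distinct elements, where $t_1$ is the type of the empty tuple, followed by the types of single elements, then the types of pairs of distinct elements, then triples, etc. The Friedman–Stanley ordering $L(G)$ is the set of finite sequences of rationals $\sigma=r_0q_1r_1\ldots r_{n-1}q_nr_nk$ ($n\ge 0$) such that $r_i\in A_0$ for $i<n$, $r_n\in A_1$, there are distinct elements $a_1,\dots,a_n$ of $G$ with $q_i\in A_{a_i}$ for $1\le i\le n$ such that $(a_1,\dots,a_n)$ realizes $t_m$ in $G$, and $k$ is a natural number with $k<m$; $L(G)$ is ordered lexicographically. An $L_{\omega_1\omega}$-definition of a relation $R\subseteq \mathcal{B}^{<\omega}$ in a structure $\mathcal{B}$ is a countable sequence of $L_{\omega_1\omega}$ formulas $\varphi_n(\bar x_n)$ (with $\bar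 x_n$ of length $n$) such that $\varphi_n$ defines $R\cap\mathcal{B}^n$; relations on tuples of $D$ (of varying arities) are defined analogously. *)

(* Defs.v *)
From mathcomp Require Import all_boot all_order all_algebra.
From mathcomp Require Import boolp classical_sets functions.

Set Implicit Arguments.
Unset Strict Implicit.
Unset Printing Implicit Defensive.

Import Order.TTheory GRing.Theory Num.Theory.

Local Open Scope classical_set_scope.
Local Open Scope nat_scope.

(* The total recursive functions: the closure of the initial functions under
   composition, primitive recursion and minimization of regular functions. *)
Inductive recursive : forall k, (k.-tuple nat -> nat) -> Prop :=
| rec_zero k : recursive (fun _ : k.-tuple nat => 0)
| rec_succ : recursive (fun v : 1.-tuple nat => (thead v).+1)
| rec_proj k (i : 'I_k) : recursive (fun v => tnth v i)
| rec_comp k n (f : n.-tuple nat -> nat) (g : 'I_n -> k.-tuple nat -> nat) :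
    recursive f -> (forall i, recursive (g i)) ->
    recursive (fun v => f [tuple g i v | i < n])
| rec_prim k (f : k.-tuple nat -> nat) (g : k.+2.-tuple nat -> nat)
    (h : k.+1.-tuple nat -> nat) :
    recursive f -> recursive g ->
    (forall v : k.-tuple nat, h [tuple of 0 :: v] = f v) ->
    (forall n (v : k.-tuple nat), h [tuple of n.+1 :: v]
                 = g [tuple of n :: h [tuple of n :: v] :: v]) ->
    recursive h
| rec_min k (f : k.+1.-tuple nat -> nat) (h : k.-tuple nat -> nat) :
    recursive f ->
    (forall v : k.-tuple nat, f [tuple of h v :: v] = 0) ->
    (forall (v : k.-tuple nat) y, y < h v -> f [tuple of y :: v] <> 0) ->
    recursive h.

Definition dense_in_rat (S : set rat) : Prop :=
  forall a b : rat, (a < b)%R -> exists2 q, S q & (a < q < b)%R.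

(* Effectiveness: the index of the block containing the rational
   (a - b) / (d + 1) is a recursive function of a, b and d. *)
Definition effective_dense_partition (A : nat -> set rat) : Prop :=
  [/\ partition setT A setT,
      forall n, dense_in_rat (A n)
    & exists2 f : 3.-tuple nat -> nat, recursive f &
        forall a b d : nat,
          A (f [tuple a; b; d]) ((a%:R - b%:R) / d.+1%:R)%R].

(* An atomic type of a tuple of distinct elements in the language {E} says
   x_i <> x_j for i <> j, and for all i, j (including i = j) says either
   E(x_i, x_j) or its negation; the entry (i, j) of [diag] tells which. *)
Record atype := AType { arity : nat; diag : 'M[bool]_arity }.

(* The list is t 1, t 2, ...; the value t 0 plays no role.  That t 1 is the type
   of the empty tuple follows, since arities do not decrease along the list. *)
Definition effective_type_list (t : nat -> atype) : Prop :=
  [/\ set_bij [set m | 0 < m] setT t,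
      forall m m', 0 < m -> m <= m' -> arity (t m) <= arity (t m'),
      exists2 f : 1.-tuple nat -> nat, recursive f &
        forall m, 0 < m -> f [tuple m] = arity (t m)
    & exists2 f : 3.-tuple nat -> nat, recursive f &
        forall m (i j : 'I_(arity (t m))), 0 < m ->
          f [tuple m; val i; val j] = nat_of_bool (diag (t m) i j)].

Record digraph := Digraph {
  vertex : set nat;
  edge : nat -> nat -> Prop;
  edge_vertex : forall x y, edge x y -> vertex x /\ vertex y }.

(* The index i : 'I_n of [a], [q] and [r] is the mathematical a_(i+1), q_(i+1)
   and r_i; [rn] is r_n. *)
Definition FS_mem (A : nat -> set rat) (t : nat -> atype) (G : digraph)
    (s : seq rat) : Prop :=
  exists m (a : 'I_(arity (t m)) -> nat) (q r : 'I_(arity (t m)) -> rat)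
         (rn : rat) (k : nat),
    [/\ s = flatten [seq [:: r i; q i] | i <- enum 'I_(arity (t m))]
            ++ [:: rn; k%:R%R],
        forall i, A 0 (r i),
        A 1 rn,
        forall i, A (a i) (q i)
      & [/\ 0 < m, k < m, injective a, forall i, vertex G (a i)
          & forall i j, diag (t m) i j <-> edge G (a i) (a j)]].

Definition FS_type (A : nat -> set rat) (t : nat -> atype) (G : digraph) : Type :=
  {s : seq rat | FS_mem A t G s}.

Definition FS_lt (A : nat -> set rat) (t : nat -> atype) (G : digraph)
    (x y : FS_type A t G) : Prop :=
  ((sval x : seqlexi rat) < sval y)%O.

(* L_omega1,omega formulas in the language {<} with free variables among
   x_0, ..., x_(n-1).  A finite conjunction or disjunction is one whose sequence
   repeats.  Quantifiers bind x_0 and shift the other variables by one. *)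
Inductive formula : nat -> Type :=
| FLt n (i j : 'I_n) : formula n
| FEq n (i j : 'I_n) : formula n
| FNot n (phi : formula n) : formula n
| FAnd n (phi : nat -> formula n) : formula n
| FOr n (phi : nat -> formula n) : formula n
| FEx n (phi : formula n.+1) : formula n
| FAll n (phi : formula n.+1) : formula n.

Section Semantics.
Variables (B : Type) (lt : B -> B -> Prop).

Fixpoint sat n (phi : formula n) : n.-tuple B -> Prop :=
  match phi with
  | FLt _ i j => fun v => lt (tnth v i) (tnth v j)
  | FEq _ i j => fun v => tnth v i = tnth v j
  | FNot _ psi => fun v => ~ sat psi v
  | FAnd _ psi => fun v => forall k, sat (psi k) v
  | FOr _ psi => fun v => exists k, sat (psi k) v
  | FEx _ psi => fun v => exists b, sat psi [tuple of b :: v]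
  | FAll _ psi => fun v => forall b, sat psi [tuple of b :: v]
  end.

Definition defined_set (phi : forall n, formula n) : set (seq B) :=
  [set x | sat (phi (size x)) (in_tuple x)].

Definition defined_rel (phi : forall m n, formula (m + n)) (x y : seq B) : Prop :=
  sat (phi (size x) (size y)) [tuple of in_tuple x ++ in_tuple y].

End Semantics.

Section Quotient.
Variables (T : Type) (D : set T) (sim E : T -> T -> Prop).

Definition equivalence_on : Prop :=
  [/\ forall x, D x -> sim x x,
      forall x y, D x -> D y -> sim x y -> sim y x
    & forall x y z, D x -> D y -> D z -> sim x y -> sim y z -> sim x z].

Definition compatible_on : Prop :=
  forall x x' y y', D x -> D x' -> D y -> D y' ->
    sim x x' -> sim y y' -> (E x y <-> E x' y').

Definition quot : set (set T) :=
  [set C | exists2 x, D x & C = [set y | D y /\ sim x y]].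

Definition quot_rel (C C' : set T) : Prop :=
  exists x y, [/\ C x, C' y & E x y].

Definition quot_isomorphic (G : digraph) : Prop :=
  exists2 f : set T -> nat, set_bij quot (vertex G) f &
    forall C C', quot C -> quot C' ->
      (quot_rel C C' <-> edge G (f C) (f C')).

End Quotient.

(* The definitions of D, ~ and E*; the last two define relations on D, so only
   their values on tuples belonging to D matter. *)
Record interp_formulas := InterpFormulas {
  dom_formula : forall n, formula n;
  sim_formula : forall m n, formula (m + n);
  edge_formula : forall m n, formula (m + n) }.

Definition interprets (I : interp_formulas) (B : Type) (lt : B -> B -> Prop)
    (G : digraph) : Prop :=
  let D := defined_set lt (dom_formula I) in
  let sim := defined_rel lt (sim_formula I) in
  let E := defined_rel lt (edge_formula I) in
  [/\ equivalence_on D sim, compatible_on D sim E & quot_isomorphic D sim E G].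

(* Main.v *)
Require Import Defs.
From mathcomp Require Import all_boot all_order all_algebra.
From mathcomp Require Import boolp classical_sets functions cardinality.
From mathcomp Require wochoice.

(** L(G) sees a tuple of vertices only through the isomorphism type of (G, tuple):
    finite tuples of L(G) lying on separate sides of a point are independent, and
    a graded back-and-forth equivalence between vertex tuples of G and of G' lifts to
    one between L(G) and L(G').

    Suppose fixed formulas interpret every G in L(G), and let G be a well-ordering.
    Moving a tuple of L(G) to an independent copy with the same vertices does not
    change the element of G that it represents: all pairs of copies z < z' behave
    alike, and there are copies on either side of one representing the least possible
    element. Hence the order between the elements represented by two tuples depends
    only on the equivalence classes of the two tuples taken separately. If G and G' are
    well-orderings that are back-and-forth equivalent up to a rank bounding the
    formulas, then matching equivalent tuples induces an isomorphism of G and G'.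

    Distinct countable ordinals that are both multiples of omega ^ r are equivalent up
    to rank r, and such ordinals are unbounded below omega_1: a contradiction. *)

Set Implicit Arguments.
Unset Strict Implicit.
Unset Printing Implicit Defensive.

Import Order.TTheory GRing.Theory Num.Theory.
Local Open Scope nat_scope.

(** Countable well-founded trees stand in for countable ordinals: a node bounds a countable family
    of ranks without forming suprema, and each move of a game descends to a child. *)
Inductive rank := Rank0 | RankS of (nat -> rank).

Definition rank_succ (s : rank) : rank := RankS (fun=> s).

(** Only the forth half is recorded; the back half is a second [system], for the swapped relation.
    Tuples grow at the head. *)
Record system (G G' : digraph) (T : rank -> seq nat -> seq nat -> Prop) : Prop :=
  System {
    system_atom : forall r a a', T r a a' ->
      [/\ size a = size a', uniq a /\ uniq a',
        forall x, x \in a -> vertex G x, forall x, x \in a' -> vertex G' x &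
        forall i j, i < size a -> j < size a ->
          edge G (nth 0 a i) (nth 0 a j) <-> edge G' (nth 0 a' i) (nth 0 a' j)];
    system_mono : forall f k a a', T (RankS f) a a' -> T (f k) a a';
    system_forth : forall f k a a' b, T (RankS f) a a' -> vertex G b -> b \notin a ->
      exists b', T (f k) (b :: a) (b' :: a') }.

(** * Back-and-forth equivalence of well-orderings *)

Definition swap {S1 S2 : Type} (p : S1 * S2) := (p.2, p.1).

Lemma swapK (S1 S2 : Type) : cancel (@swap S1 S2) (@swap S2 S1).
Proof. by case. Qed.

Section WellOrder.
Variables (W : eqType) (lt : W -> W -> Prop).
Hypotheses (lt_irr : forall x, ~ lt x x)
  (lt_trans : forall y x z, lt x y -> lt y z -> lt x z)
  (lt_total : forall x y, [\/ lt x y, x = y | lt y x])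
  (lt_wf : well_founded lt).

Local Notation "x ≺ y" := (lt x y) (at level 70).
Local Notation "x ≼ y" := (~ lt y x) (at level 70).

Lemma nlt_lt_trans y x z : x ≼ y -> y ≺ z -> x ≺ z.
Proof. by case: (lt_total x y) => [xy _|-> //|yx /(_ yx)//]; apply: lt_trans. Qed.

Lemma lt_nlt_trans y x z : x ≺ y -> y ≼ z -> x ≺ z.
Proof. by case: (lt_total y z) => [yz xy _|-> //|zy _ /(_ zy)//]; apply: lt_trans yz. Qed.

Lemma nlt_trans y x z : x ≼ y -> y ≼ z -> x ≼ z.
Proof. by move=> xy yz zx; apply: yz; apply: lt_nlt_trans zx xy. Qed.

Lemma lt_nlt x y : x ≺ y -> x ≼ y.
Proof. by move=> xy yx; apply: (@lt_irr x); apply: lt_trans yx. Qed.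

Lemma nlt_eqVlt x y : x ≼ y -> x = y \/ x ≺ y.
Proof. by case: (lt_total x y) => [|->|yx /(_ yx)//]; [right|left]. Qed.

Lemma wf_min (P : W -> Prop) :
  (exists x, P x) -> exists2 x, P x & forall y, P y -> x ≼ y.
Proof.
move=> [x]; elim/(well_founded_ind lt_wf): x => x IH Px.
have [[y [Py yx]]|H] := pselect (exists y, P y /\ y ≺ x); first exact: IH yx Py.
by exists x => // y Py yx; apply: H; exists y.
Qed.

(* [lim s a] says that the order type of the points below [a] is a multiple of
   omega ^ |s|, where |s| is the ordinal rank of the tree [s]. *)
Fixpoint lim (s : rank) (a : W) : Prop :=
  match s with
  | Rank0 => True
  | RankS f => forall k b, b ≺ a -> exists c, [/\ b ≺ c, c ≺ a & lim (f k) c]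
  end.

(** A point of [lim s] strictly between [b] and [a] already has between itself and [b] the point
    that [lim s a] asks for. So multiples of omega ^ |s| are closed under limits. *)
Lemma lim_lim s a :
  (forall b, b ≺ a -> exists c, [/\ b ≺ c, c ≺ a & lim s c]) -> lim s a.
Proof.
case: s => // f H k b ba; have [c [bc ca /= Lc]] := H _ ba.
have [d [bd dc Ld]] := Lc k _ bc; exists d; split=> //; exact: lt_trans ca.
Qed.

Lemma lim_mono f k a : lim (RankS f) a -> lim (f k) a.
Proof. by move=> L; apply: lim_lim => b ba; apply: L. Qed.

(** The multiples of omega ^ |s| up to [x] have a least upper bound [d], and closure under limits
    puts [d] among them: otherwise every point below [d] would have a multiple between itself and
    [d]. *)
Lemma last_lim s b x :
    (exists c, [/\ b ≺ c, c ≼ x & lim s c]) ->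
  exists c, [/\ b ≺ c, c ≼ x, lim s c &
    forall c', lim s c' -> c' ≼ x -> c' ≼ c].
Proof.
move=> [c0 [bc0 c0x Lc0]].
have [|d ubd mind] := @wf_min
  (fun d => d ≼ x /\ forall c', lim s c' -> c' ≼ x -> c' ≼ d).
  by exists x; split=> //; apply: lt_irr.
case: ubd => dx ubd; exists d; split=> //.
  by apply: lt_nlt_trans bc0 _; apply: ubd.
apply: contrapT => nL; apply: (nL); apply: lim_lim => e ed.
have : ~ (e ≼ x /\ forall c', lim s c' -> c' ≼ x -> c' ≼ e).
  by move=> /mind; apply.
move/not_andP => [|/existsNP [c /not_implyP[Lc /not_implyP[cx /contrapT ec]]]].
  by move=> /contrapT xe; case: dx; apply: lt_trans ed.
exists c; split=> //; have [cd|//] := nlt_eqVlt (ubd c Lc cx).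
by rewrite cd in Lc.
Qed.

(** * Isomorphic intervals *)

Section Similarity.
Variables s s' : W.

Definition bisimulation (R : W -> W -> Prop) := forall x x', R x x' ->
  [/\ s ≼ x, s' ≼ x',
    forall y, s ≼ y -> y ≺ x -> exists y', [/\ s' ≼ y', y' ≺ x' & R y y']
  & forall y', s' ≼ y' -> y' ≺ x' -> exists y, [/\ s ≼ y, y ≺ x & R y y']].

(** This amounts to an isomorphism of the intervals [s, x) and [s', x'). Taking the union of all
    bisimulations avoids building a map by recursion. *)
Definition similar x x' := exists2 R, bisimulation R & R x x'.

Lemma similar_bisim : bisimulation similar.
Proof.
move=> x x' [R BR Rxx']; have [sx sx' F B] := BR _ _ Rxx'; split=> //.
  move=> y sy yx; have [y' [? ? Ryy']] := F y sy yx.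
  by exists y'; split=> //; exists R.
move=> y' sy yx; have [y [? ? Ryy']] := B y' sy yx.
by exists y; split=> //; exists R.
Qed.

(** If [v] is below [u] and both are similar to [x], then [v] is matched with some [z] below [x],
    and [z] with some [z'] below [v]; induction at [z] gives z' = v, which is absurd. *)
Lemma similar_fun x x' x'' : similar x x' -> similar x x'' -> x' = x''.
Proof.
elim/(well_founded_ind lt_wf): x x' x'' => x IH.
have nlt u v : similar x u -> similar x v -> u ≼ v.
  move=> Su Sv vu; have [_ sv Fv _] := similar_bisim Sv.
  have [_ _ _ Bu] := similar_bisim Su.
  have [z [sz zx Sz]] := Bu v sv vu.
  have [z' [_ zv Sz']] := Fv z sz zx.
  by move: zv; rewrite (IH z zx _ _ Sz' Sz); apply: lt_irr.
by move=> x' x'' S1 S2; case: (lt_total x' x'') => // [/(nlt _ _ S2 S1)|/(nlt _ _ S1 S2)].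
Qed.

Lemma similar_mono x x' y y' :
  similar x x' -> similar y y' -> y ≺ x -> y' ≺ x'.
Proof.
move=> Sx Sy yx; have [_ _ F _] := similar_bisim Sx.
have [sy _ _ _] := similar_bisim Sy.
by have [z [_ zx /(similar_fun Sy)->]] := F y sy yx.
Qed.

Lemma similar0 : similar s s'.
Proof.
exists (fun x x' => x = s /\ x' = s') => // x x' [-> ->].
by split; [exact: lt_irr|exact: lt_irr|move=> y sy ys; case: sy..].
Qed.

End Similarity.

Lemma similarC s s' x x' : similar s s' x x' -> similar s' s x' x.
Proof.
move=> [R BR Rxx']; exists (fun u u' => R u' u) => // u u' /BR[? ? F B].
by split.
Qed.

Lemma similar_restart s s' x x' y y' :
  similar s s' x x' -> similar s s' y y' -> y ≼ x -> similar y y' x x'.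
Proof.
move=> Sx Sy yx.
have key t t' u u' v v' : similar t t' u u' -> similar t t' v v' -> v ≼ u ->
    v' ≼ u'.
  move=> Su Sv /nlt_eqVlt[vu|vu]; last by apply: lt_nlt; apply: similar_mono Su Sv vu.
  by rewrite vu in Sv; rewrite (similar_fun Su Sv); apply: lt_irr.
exists (fun u u' => [/\ similar s s' u u', y ≼ u & y' ≼ u']); last first.
  by split=> //; apply: key Sx Sy yx.
have [sy sy' _ _] := similar_bisim Sy.
move=> u u' [Su yu yu']; have [_ _ F B] := similar_bisim Su; split=> //.
  move=> z yz zu; have [z' [? ? Sz]] := F z (nlt_trans sy yz) zu.
  have yz' := key _ _ _ _ _ _ Sz Sy yz; by exists z'.
move=> z' yz' zu'; have [z [? ? Sz]] := B z' (nlt_trans sy' yz') zu'.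
have yz := key _ _ _ _ _ _ (similarC Sz) (similarC Sy) yz'; by exists z.
Qed.

(** Whether [x] is a multiple depends only on the points just below [x], and these are transported
    once both intervals are nonempty. *)
Lemma similar_lim s s' r x x' :
  similar s s' x x' -> s ≺ x -> s' ≺ x' -> lim r x -> lim r x'.
Proof.
elim: r x x' => // f IH x x' Sx sx sx' Lx k b' bx'.
(* The similarity says nothing below [s'], so [b'] is replaced by the maximum of [b'] and [s']. *)
have [b [bb' sb bx'']] : exists b, [/\ b' ≼ b, s' ≼ b & b ≺ x'].
  case: (lt_total s' b') => [sb|->|bs]; [exists b'|exists b'|exists s'];
    by split=> //; do ?[exact: lt_nlt|exact: lt_irr].
have [_ _ F B] := similar_bisim Sx.
have [a [sa ax Sa]] := B b sb bx''.
have [c [ac cx Lc]] := Lx k a ax.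
have sc := nlt_lt_trans sa ac.
have [c' [_ cx' Sc]] := F c (lt_nlt sc) cx.
have bc := similar_mono Sc Sa ac.
exists c'; split=> //; first exact: nlt_lt_trans bc.
by apply: (IH k c c') => //; apply: nlt_lt_trans bc.
Qed.

(** Comparability of well-orderings, by induction on [x]: when all points of [s, x) have partners
    below [d'], the least point of [s', d'] that is not such a partner is the partner of [x]. *)
Lemma similar_compare s s' x d' : s ≼ x -> s' ≼ d' ->
  (exists2 x', x' ≺ d' & similar s s' x x') \/
  (exists2 y, y ≼ x & similar s s' y d').
Proof.
move=> + sd; elim/(well_founded_ind lt_wf): x => x IH sx.
have [[y [sy yx nS]]|H] := pselect (exists y, [/\ s ≼ y, y ≺ x &
    ~ exists2 x', x' ≺ d' & similar s s' y x']).
  have [//|[z zy Sz]] := IH y yx sy; right; exists z => //.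
  by apply: nlt_trans zy (lt_nlt yx).
have {}H y : s ≼ y -> y ≺ x -> exists2 x', x' ≺ d' & similar s s' y x'.
  by move=> sy yx; apply: contrapT => nS; apply: H; exists y.
have [|x' [sx' x'd nx] minx] := @wf_min (fun x' => [/\ s' ≼ x', x' ≼ d' &
    ~ exists y, [/\ s ≼ y, y ≺ x & similar s s' y x']]).
  exists d'; split=> //.
  move=> [y [sy /(H y sy)[z zd Sz] Sy]].
  by move: zd; rewrite (similar_fun Sz Sy); apply: lt_irr.
have Sx : similar s s' x x'.
  exists (fun u u' => similar s s' u u' \/ (u = x /\ u' = x')); last by right.
  move=> u u' [Su|[-> ->]].
    have [? ? F B] := similar_bisim Su; split=> //.
      by move=> y sy yu; have [y' [? ? ?]] := F y sy yu; exists y'; split=> //; left.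
    by move=> y sy yu; have [y' [? ? ?]] := B y sy yu; exists y'; split=> //; left.
  split=> //.
    move=> y sy yx; have [y' yd Sy] := H y sy yx.
    have [_ sy' F B] := similar_bisim Sy.
    exists y'; split=> //; last by left.
    case: (lt_total y' x') => // [yx'|xy'].
      by case: nx; exists y; rewrite -yx'.
    have [z [? zy Sz]] := B x' sx' xy'; case: nx; exists z; split=> //.
    exact: lt_trans yx.
  move=> y' sy' yx'; apply: contrapT => nS; apply: (minx y') => //.
  split=> //; first by apply: lt_nlt; apply: lt_nlt_trans x'd.
  by move=> [y [? ? ?]]; apply: nS; exists y; split=> //; left.
have [x'd'|x'd'] := nlt_eqVlt x'd; last by left; exists x'.
by right; exists x; [exact: lt_irr|rewrite -x'd'].
Qed.

(* The order types of [s, x) and [s', x') agree, or become equal after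
   subtracting positive multiples of omega ^ |r|. *)
Definition interval_eqv (r : rank) s x s' x' :=
  similar s s' x x' \/ exists c c', [/\ s ≺ c /\ c ≼ x, s' ≺ c' /\ c' ≼ x',
    lim r c, lim r c' & similar c c' x x'].

Lemma interval_eqvC r s x s' x' :
  interval_eqv r s x s' x' -> interval_eqv r s' x' s x.
Proof.
move=> [/similarC|[c [c' [? ? ? ? /similarC]]]]; first by left.
by right; exists c', c.
Qed.

Lemma interval_eqv_mono f k s x s' x' :
  interval_eqv (RankS f) s x s' x' -> interval_eqv (f k) s x s' x'.
Proof.
move=> [|[c [c' [? ? L L' S]]]]; first by left.
by right; exists c, c'; split=> //; apply: lim_mono.
Qed.

(** The main case is [y] below [c]. Then [y, x) is again compared through [c] and [c'], while [s, y)
    is cut at the last multiple of omega ^ |f k| above [s] and up to [y]. The remainder is shorter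
    than the distance between two multiples, so it fits below [c']. *)
Lemma interval_eqv_forth f k s x s' x' y :
    interval_eqv (RankS f) s x s' x' -> s ≺ y -> y ≺ x ->
  exists y', [/\ s' ≺ y' /\ y' ≺ x', interval_eqv (f k) s y s' y' &
    interval_eqv (f k) y x y' x'].
Proof.
move=> [S|[c [c' [[sc cx] [sc' cx'] L L' S]]]] sy yx.
  have [_ _ F _] := similar_bisim S.
  have [y' [sy' yx' Sy]] := F y (lt_nlt sy) yx.
  exists y'; split; last by left; apply: similar_restart Sy (lt_nlt yx).
    by split=> //; apply: similar_mono Sy (similar0 s s') sy.
  by left.
have Lk := lim_mono k L; have Lk' := lim_mono k L'.
have [yc|cy] := pselect (y ≺ c); last first.
  have [_ _ F _] := similar_bisim S.
  have [y' [cy' yx' Sy]] := F y cy yx.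
  exists y'; split; last by left; apply: similar_restart Sy (lt_nlt yx).
    by split=> //; apply: lt_nlt_trans cy'.
  by right; exists c, c'.
suff [y' [sy' yc' Sy]] : exists y', [/\ s' ≺ y', y' ≺ c' &
    interval_eqv (f k) s y s' y'].
  exists y'; split=> //; first by split=> //; apply: lt_nlt_trans cx'.
  by right; exists c, c'.
have [d' [sd' dc' Ld']] := L' k _ sc'.
have [Hd|Hd] := pselect (exists d, [/\ s ≺ d, d ≼ y & lim (f k) d]).
  (* [d'] and [e'] are two multiples below [c']. If [d', e') fitted into [d, y), the image of [e']
     would be a multiple after [d] and not above [y]. *)
  have [d [sd dy Ld maxd]] := last_lim Hd.
  have [e' [de' ec' Le']] := L' k _ dc'.
  have [[y' ye' Sy]|[z zy Sz]] := similar_compare dy (lt_nlt de').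
    have [_ dy' _ _] := similar_bisim Sy.
    exists y'; split; first exact: lt_nlt_trans dy'.
      exact: lt_trans ec'.
    by right; exists d, d'.
  have dz := similar_mono (similarC Sz) (similar0 d' d) de'.
  by case: (maxd z _ zy) => //; apply: similar_lim (similarC Sz) _ _ Le'.
(* With no multiple above [s] and up to [y], the whole of [s, y) is shorter than [s', d'). *)
have [[y' yd' Sy]|[z zy Sz]] := similar_compare (lt_nlt sy) (lt_nlt sd').
  exists y'; split; [exact: similar_mono Sy (similar0 _ _) sy| |by left].
  exact: lt_trans dc'.
have sz := similar_mono (similarC Sz) (similar0 s' s) sd'.
case: Hd; exists z; split=> //.
by apply: similar_lim (similarC Sz) _ _ Ld'.
Qed.

Definition matching (r : rank) (L : seq (W * W)) :=
  (forall p q, p \in L -> q \in L -> (p.1 ≺ q.1 <-> p.2 ≺ q.2)) /\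
  (forall p q, p \in L -> q \in L -> p.1 ≺ q.1 ->
    (forall t, t \in L -> t.1 ≼ p.1 \/ q.1 ≼ t.1) ->
    interval_eqv r p.1 q.1 p.2 q.2).

Lemma matching_mono f k L : matching (RankS f) L -> matching (f k) L.
Proof.
move=> [O I]; split=> // p q pL qL pq H; apply: interval_eqv_mono; exact: I.
Qed.

Lemma eq_mem_matching r L L' : L =i L' -> matching r L -> matching r L'.
Proof.
move=> E [O I]; split=> [p q|p q]; rewrite -!E; first exact: O.
by move=> pL qL pq H; apply: I => // t tL; apply: H; rewrite -E.
Qed.

Lemma matching_eq r L p q : matching r L -> p \in L -> q \in L ->
  p.1 = q.1 <-> p.2 = q.2.
Proof.
move=> [O _] pL qL; have O1 := O p q pL qL; have O2 := O q p qL pL; split=> E.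
  by case: (lt_total p.2 q.2) => // [/O1|/O2]; rewrite E => /lt_irr.
by case: (lt_total p.1 q.1) => // [/O1|/O2]; rewrite E => /lt_irr.
Qed.

Lemma matching_swap r L : matching r L -> matching r (map swap L).
Proof.
move=> [O I].
have M p : p \in map swap L -> swap p \in L.
  by case/mapP=> q qL ->; rewrite swapK.
split=> [p q /M pL /M qL|p q /M pL /M qL pq H]; first by have := O _ _ pL qL; tauto.
apply: interval_eqvC; apply: (I (swap p) (swap q)) => //; first by apply/O.
move=> t tL; case: (H (swap t)) => [|pt|qt]; first exact: map_f.
  by left; rewrite O.
by right; rewrite O.
Qed.

Lemma seq_max (L : seq (W * W)) (P : W * W -> Prop) :
    (exists2 p, p \in L & P p) ->
  exists p, [/\ p \in L, P p & forall q, q \in L -> P q -> q.1 ≼ p.1].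
Proof.
elim: L => [[p]//|a L IH [p0 p0L Pp0]].
have [/IH[p [pL Pp mp]]|nL] := pselect (exists2 p, p \in L & P p).
  have [[Pa pa]|n] := pselect (P a /\ p.1 ≺ a.1).
    exists a; split=> //; first exact: mem_head.
    move=> q; rewrite inE => /predU1P[-> _|qL Pq]; first exact: lt_irr.
    by apply: nlt_trans (lt_nlt pa); apply: mp.
  exists p; split=> //; first by rewrite inE pL orbT.
  move=> q; rewrite inE => /predU1P[-> Pa pa|qL Pq]; last exact: mp.
  exact: n.
have e : p0 = a.
  by move: p0L; rewrite inE => /predU1P[//|p0L]; case: nL; exists p0.
exists a; split; [exact: mem_head|by rewrite -e|].
move=> q; rewrite inE => /predU1P[-> _|qL Pq]; first exact: lt_irr.
by case: nL; exists q.
Qed.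

(** A point already listed keeps its partner. Otherwise only the gap between the neighbours [p] and
    [q] of [y] is split, and [interval_eqv_forth] answers inside it. *)
Lemma matching_forth f k L y : matching (RankS f) L ->
    (exists2 p, p \in L & p.1 ≼ y) -> (exists2 q, q \in L & y ≺ q.1) ->
  exists y', matching (f k) ((y, y') :: L).
Proof.
move=> ML lo hi.
have [[p pL py]|nL] := pselect (exists2 p, p \in L & p.1 = y).
  exists p.2; apply: eq_mem_matching (matching_mono k ML) => z.
  rewrite -py -surjective_pairing inE.
  by apply/idP/orP => [->|[/eqP->|]//]; right.
have [p [pL py maxp]] : exists p, [/\ p \in L, p.1 ≺ y &
    forall q, q \in L -> q.1 ≺ y -> q.1 ≼ p.1].
  apply: seq_max; have [p pL /nlt_eqVlt[py|py]] := lo; last by exists p.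
  by case: nL; exists p.
have [w [q [qL qy] qw] minq] : exists2 w, (exists2 q, q \in L /\ y ≺ q.1 & q.1 = w) &
    forall v, (exists2 q, q \in L /\ y ≺ q.1 & q.1 = v) -> w ≼ v.
  by apply: wf_min; have [q qL qy] := hi; exists q.1, q.
subst w.
have {}minq u : u \in L -> y ≺ u.1 -> q.1 ≼ u.1 by move=> uL yu; apply: minq; exists u.
have [O I] := ML; have pq := lt_trans py qy.
have adj t : t \in L -> t.1 ≼ p.1 \/ q.1 ≼ t.1.
  move=> tL; case: (lt_total t.1 y) => [ty|ty|yt]; first by left; apply: maxp.
    by case: nL; exists t.
  by right; apply: minq.
have [y' [[py' yq'] Ipy Iyq]] := interval_eqv_forth k (I p q pL qL pq adj) py qy.
have below u : u \in L -> u.1 ≺ y -> u.2 ≺ y'.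
  by move=> uL uy; apply: nlt_lt_trans py' => /(O p u pL uL).2; apply: maxp.
have above u : u \in L -> y ≺ u.1 -> y' ≺ u.2.
  by move=> uL yu; apply: lt_nlt_trans yq' _ => /(O u q uL qL).2; apply: minq.
exists y'; split=> [u v|u v].
  rewrite !inE => /predU1P[->|uL] /predU1P[->|vL] /=; last exact: O.
  - by split=> /lt_irr.
  - split=> [|yv]; first exact: above.
    case: (lt_total y v.1) => // [vy|/(below v vL)/(lt_nlt)//].
    by case: nL; exists v.
  - split=> [|yu]; first exact: below.
    case: (lt_total y u.1) => // [/(above u uL)/(lt_nlt)//|uy].
    by case: nL; exists u.
rewrite !inE => /predU1P[->|uL] /predU1P[->|vL] /= uv H.
- by case: (lt_irr uv).
- have vq : v.1 = q.1.
    have [//|qv] := nlt_eqVlt (minq v vL uv).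
    by case: (H q) => [|/(_ qy)//|/(_ qv)//]; rewrite inE qL orbT.
  by have /(_ vq) := (matching_eq ML vL qL).1; rewrite vq => ->.
- have up : u.1 = p.1.
    have [//|up] := nlt_eqVlt (maxp u uL uv).
    by case: (H p) => [|/(_ up)//|/(_ py)//]; rewrite inE pL orbT.
  by have /(_ up) := (matching_eq ML uL pL).1; rewrite up => ->.
apply: interval_eqv_mono; apply: I => // t tL; apply: H.
by rewrite inE tL orbT.
Qed.

(** * Initial segments as graphs on natural numbers *)

Definition segment_edge (e : W) (i : W -> nat) (m n : nat) :=
  exists v w, [/\ v ≺ w, w ≺ e, m = i v & n = i w].

Lemma segment_edge_vertex e i m n : segment_edge e i m n ->
  [set i w | w in [set w | w ≺ e]]%classic m /\ [set i w | w in [set w | w ≺ e]]%classic n.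
Proof.
move=> [v [w [vw we -> ->]]]; split; [exists v|exists w] => //=.
exact: lt_trans we.
Qed.

Definition segment e i : digraph := Digraph (@segment_edge_vertex e i).

Definition injective_below e (i : W -> nat) :=
  forall v w, v ≺ e -> w ≺ e -> i v = i w -> v = w.

(** The pairs (o, o) and (e, e') fix the ends of both orders, so that every point still to be
    matched has listed points on both sides. *)
Definition segment_system o e e' (i i' : W -> nat) (r : rank) (a a' : seq nat) :=
  exists2 L : seq (W * W), [/\ a = [seq i p.1 | p <- L], a' = [seq i' p.2 | p <- L],
    uniq a, uniq a' & forall p, p \in L -> p.1 ≺ e /\ p.2 ≺ e'] &
    matching r [:: (o, o), (e, e') & L].

Lemma segment_system_swap o e e' i i' r a a' :
  segment_system o e e' i i' r a a' -> segment_system o e' e i' i r a' a.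
Proof.
move=> [L [-> -> ua ua' bL] ML]; exists (map swap L); last exact: (matching_swap ML).
split=> //; do ?by rewrite -map_comp.
by move=> p /mapP[q qL ->]; have [] := bL q qL.
Qed.

Lemma segmentE e i v w : injective_below e i -> v ≺ e -> w ≺ e ->
  edge (segment e i) (i v) (i w) <-> v ≺ w.
Proof.
move=> inj ve we; split=> [[v' [w' [vw we' iv iw]]]|vw]; last by exists v, w.
rewrite (inj w w') // (inj v v') //; exact: lt_trans we'.
Qed.

Lemma segment_systemP o e e' i i' :
    (forall x, o ≼ x) -> injective_below e i -> injective_below e' i' ->
  system (segment e i) (segment e' i') (segment_system o e e' i i').
Proof.
move=> mino inj inj'; split=> [r a a'|f k a a'|f k a a' b].
- move=> [L [-> -> ua ua' bL] ML]; split=> //; first by rewrite !size_map.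
  + by move=> x /mapP[p pL ->]; exists p.1; first by have [] := bL p pL.
  + by move=> x /mapP[p pL ->]; exists p.2; first by have [] := bL p pL.
  + move=> m n; rewrite size_map => ml nl.
    have mL := mem_nth (o, o) ml; have nL := mem_nth (o, o) nl.
    rewrite !(nth_map (o, o)) //.
    have [? ?] := bL _ mL; have [? ?] := bL _ nL.
    rewrite !segmentE //; apply: ML.1; by rewrite !inE ?mL ?nL !orbT.
- move=> [L H ML]; exists L => //; exact: matching_mono.
- move=> [L [-> -> ua ua' bL] ML] [y ye <-] nb.
  have [||y' My] := matching_forth k (y := y) ML.
  + by exists (o, o); [exact: mem_head|exact: mino].
  + by exists (e, e') => //; rewrite !inE eqxx orbT.
  have ye' : y' ≺ e'.
    by apply/(My.1 (y, y') (e, e')) => //; rewrite !inE eqxx ?orbT.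
  exists (i' y'); exists ((y, y') :: L); last first.
    apply: eq_mem_matching My => z; rewrite !inE.
    by case: (z == _); case: (z == _); case: (z == _).
  split=> //=; first by rewrite nb.
    rewrite ua' andbT; apply/mapP => -[p pL E].
    have [pe pe'] := bL p pL.
    case/mapP: nb; exists p => //; congr i.
    apply/(matching_eq My (p := (y, y')) (q := p)); rewrite ?mem_head //.
      by rewrite !inE pL !orbT.
    exact: inj' E.
  by move=> p; rewrite inE => /predU1P[->|/bL].
Qed.

Lemma segment_system0 o e e' i i' r : o ≺ e -> o ≺ e' -> lim r e -> lim r e' ->
  segment_system o e e' i i' r [::] [::].
Proof.
move=> oe oe' Le Le'; exists [::] => //.
have ltoe := lt_nlt oe; have ltoe' := lt_nlt oe'.
have Ie : interval_eqv r o e o e'.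
  right; exists e, e'; split=> //; last exact: similar0.
split=> p q; rewrite !inE => /orP[]/eqP-> /orP[]/eqP-> //=; by [split=> /lt_irr|move=> /lt_irr].
Qed.

(** No well-ordering is isomorphic to a proper initial segment. Let [w] be least among the points
    related to a smaller [v]; the point [u] related to [v] is below [v] because [R] respects edges,
    so [v] contradicts the choice of [w]. *)
Lemma segment_rel_lt e e' i i' (R : nat -> nat -> Prop) :
    injective_below e i -> injective_below e' i' -> e ≺ e' ->
    (forall m', vertex (segment e' i') m' -> exists2 m, vertex (segment e i) m & R m m') ->
    (forall m n m' n', R m m' -> R n n' ->
      edge (segment e i) m n <-> edge (segment e' i') m' n') -> False.
Proof.
move=> inj inj' ee' surj ER.
have pre w : w ≺ e' -> exists2 v, v ≺ e & R (i v) (i' w).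
  move=> we; have [|m [v ve <-] Rm] := surj (i' w); first by exists w.
  by exists v.
have [|w [we [v [vw ve Rvw]]] minw] :=
    @wf_min (fun w => w ≺ e' /\ exists v, [/\ v ≺ w, v ≺ e & R (i v) (i' w)]).
  by exists e; split=> //; have [v ve Rv] := pre e ee'; exists v.
have ve' := lt_trans vw we; have [u ue Ru] := pre v ve'.
apply: (minw v) => //; split=> //; exists u; split=> //.
by apply/(segmentE inj ue ve)/(ER _ _ _ _ Ru Rvw)/segmentE.
Qed.

Lemma segment_min e i (P : nat -> Prop) :
    injective_below e i -> (exists2 m, vertex (segment e i) m & P m) ->
  exists m, [/\ vertex (segment e i) m, P m &
    forall n, vertex (segment e i) n -> P n -> ~ edge (segment e i) n m].
Proof.
move=> inj [m [w we <-] Pm].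
have [|v [ve Pv] minv] := @wf_min (fun w => w ≺ e /\ P (i w)); first by exists w.
exists (i v); split=> //; first by exists v.
by move=> n [u ue <-] Pu; rewrite segmentE //; apply: minv.
Qed.

Lemma segment_total e i m n : vertex (segment e i) m -> vertex (segment e i) n ->
  [\/ edge (segment e i) m n, m = n | edge (segment e i) n m].
Proof.
move=> [v ve <-] [w we <-]; case: (lt_total v w) => [vw|->|wv].
- by constructor 1; exists v, w.
- by constructor 2.
- by constructor 3; exists w, v.
Qed.

(** * Multiples of powers of omega below omega_1 *)

Section FirstUncountable.
Hypotheses (countable_below : forall x, countable [set y | y ≺ x]%classic)
  (uncountable : ~ countable [set: W]%classic).

(** Otherwise the countable sets of points up to [u n] would cover [W]. *)
Lemma seq_bounded (u : nat -> W) : exists a, forall n, u n ≺ a.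
Proof.
apply: contrapT => nb; apply: uncountable.
have -> : [set: W]%classic =
    (\bigcup_p (if p.2 then [set y | y ≺ u p.1] else [set u p.1]))%classic.
  apply/seteqP; split=> // x _; apply: contrapT => nx; apply: nb; exists x => n.
  case: (lt_total (u n) x) => // [e|xu]; case: nx.
    by exists (n, false) => //=.
  by exists (n, true) => //=.
by apply: bigcup_countable => // -[n []] _ //=; apply: countable1.
Qed.

Lemma exists_lim r b : exists2 a, b ≺ a & lim r a.
Proof.
elim: r b => [|f IH] b.
  by have [a ab] := seq_bounded (fun=> b); exists a => //; apply: ab 0.
(* Above [x], choose for every [k] a point of [lim (f k)]; a bound of all these points serves as the
   next value. *)
have next x : exists y, x ≺ y /\ forall k, exists c, [/\ x ≺ c, c ≺ y & lim (f k) c].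
  have /choice[c Pc] : forall k, exists c, x ≺ c /\ lim (f k) c.
    by move=> k; have [c xc Lc] := IH k x; exists c.
  have [y cy] := seq_bounded c; exists y; split.
    by apply: lt_trans (cy 0); have [] := Pc 0.
  by move=> k; exists (c k); have [] := Pc k.
have [g Pg] := choice next.
(* [a] is the supremum of the iterates of [g]: some iterate passes any given point below [a], and
   the next step of [g] then supplies a multiple for each [k]. *)
have [|a ua mina] := @wf_min (fun a => forall n, iter n g b ≺ a).
  exact: seq_bounded.
exists a => [|k x xa]; first exact: ua 0.
have /existsNP[n xu] : ~ (forall n, iter n g b ≺ x) by move=> /mina.
have [_ /(_ k)[c [uc cg Lc]]] := Pg (iter n g b).
exists c; split=> //; first exact: nlt_lt_trans uc.
exact: lt_trans (ua n.+1).
Qed.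

End FirstUncountable.

End WellOrder.

(** * A well-ordering of type omega_1 *)

Lemma uncountable_cantor (T : choiceType) (f : (nat -> bool) -> T) :
  injective f -> ~ countable [set: T]%classic.
Proof.
move=> injf /countable_injP[i inji].
have inj h h' : i (f h) = i (f h') -> h = h'.
  by move=> E; apply: injf; apply: inji => //; rewrite inE.
pose P n (h : nat -> bool) := i (f h) = n.
(* The diagonal function: at its own index it would have to differ from itself. *)
pose d n := `[< forall h, P n h -> h n = false >].
have := erefl (d (i (f d))); rewrite {1}/d; case: asboolP => [H|H].
  by rewrite (H d).
by move=> E; apply: H => h /inj ->; rewrite -E.
Qed.

Definition strict_well_order (T : Type) (lt : T -> T -> Prop) :=
  [/\ forall x, ~ lt x x, forall y x z, lt x y -> lt y z -> lt x z,
    forall x y, [\/ lt x y, x = y | lt y x] & well_founded lt].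

(** The well-ordering principle provides unique minima of nonempty predicates; totality,
    antisymmetry and transitivity are read off from the minima of sets of at most three elements. *)
Lemma exists_strict_well_order (T : eqType) :
  exists lt : T -> T -> Prop, strict_well_order lt.
Proof.
have [R woR] := wochoice.well_ordering_principle T.
have wo (P : T -> Prop) : (exists x, P x) ->
    exists2 x, P x & forall y, P y -> R x y.
  move=> [x Px]; have [|z [[/asboolP Pz mz] _]] := woR (fun z => `[< P z >]).
    by exists x; apply/asboolP.
  by exists z => // y Py; apply: mz; apply/asboolP.
have total x y : R x y || R y x.
  have [|z [->|->] mz] := wo (fun z => z = x \/ z = y); first by exists x; left.
    by rewrite mz //; right.
  by rewrite (mz x) ?orbT //; left.
have anti x y : R x y -> R y x -> x = y.
  move=> xy yx; have [|z [_ uz]] := woR (pred2 x y); first by exists x; rewrite inE eqxx.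
  have refl t : R t t by have := total t t; rewrite orbb.
  have lx : wochoice.minimum_of R (pred2 x y) x.
    by split=> [|t]; rewrite inE ?eqxx // => /orP[]/eqP->.
  have ly : wochoice.minimum_of R (pred2 x y) y.
    by split=> [|t]; rewrite inE ?eqxx ?orbT // => /orP[]/eqP->.
  exact: etrans (esym (uz x lx)) (uz y ly).
have min3 x y z : exists2 t, [\/ t = x, t = y | t = z] & [&& R t x, R t y & R t z].
  have [|t Pt mt] := wo (fun t => [\/ t = x, t = y | t = z]).
    by exists x; constructor 1.
  exists t => //; apply/and3P; split; apply: mt;
    by [constructor 1|constructor 2|constructor 3].
exists (fun x y => ~~ R y x); split=> [x|y x z xy yz|x y|x].
- by have := total x x; rewrite orbb => ->.
- apply/negP => zx; have [t [] -> /and3P[tx ty tz]] := min3 x y z.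
  + by move/negP: yz; apply; rewrite (anti x z) // in ty *; rewrite (anti z x).
  + by rewrite tx in xy.
  + by rewrite ty in yz.
- have [yx|] := boolP (R y x); last by constructor 1.
  have [xy|] := boolP (R x y); last by constructor 3.
  by constructor 2; apply: anti.
- apply: contrapT => nA.
  have [|z nAz mz] := wo (fun z => ~ Acc (fun x y => ~~ R y x) z); first by exists x.
  apply: nAz; constructor => y /negP zy; apply: contrapT => nAy.
  exact/zy/mz.
Qed.

(** The points with countably many predecessors in a well-ordering of Cantor space. If they were
    countable, the least point outside them would have countably many predecessors; and if no point
    is outside, Cantor space would be countable. *)
Lemma first_uncountable : exists (W : eqType) (lt : W -> W -> Prop),
  [/\ strict_well_order lt, forall x, countable [set y | lt y x]%classic &
    ~ countable [set: W]%classic].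
Proof.
pose T : choiceType := {classic nat -> bool}.
have [lt [irr trans total wf]] := exists_strict_well_order T.
pose C x := `[< countable [set y | lt y x]%classic >].
have min (P : T -> Prop) : (exists x, P x) ->
    exists2 x, P x & forall y, P y -> ~ lt y x by apply: wf_min.
exists {x | C x}, (fun x y => lt (val x) (val y)); split.
- split=> [x|y x z|x y|].
  + exact: irr.
  + exact: trans.
  + case: (total (val x) (val y)) => [?|/val_inj ?|?];
      by [constructor 1|constructor 2|constructor 3].
  + move=> u; have := wf (val u); move: {-1}(val u) (erefl (val u)) => x + Ax.
    by elim: Ax u => {}x _ IH u E; constructor => v; rewrite E => /IH; apply.
- move=> x; have /asboolP/countable_injP[i inji] := valP x.
  apply/countable_injP; exists (i \o val) => u v; rewrite !inE /= => ux vx E.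
  by apply/val_inj/inji; rewrite ?inE.
- move=> /countable_injP[i inji].
  have sub (S : set T) : (forall x, S x -> C x) -> countable S.
    move=> SC; apply/countable_injP.
    exists (fun x => if insub x is Some u then i u else 0) => x y.
    rewrite !inE => /SC Cx /SC Cy; rewrite !insubT => /inji E.
    by have /(congr1 val) := E (mem_set I) (mem_set I).
  have [H|] := pselect (forall x, C x).
    by apply: (@uncountable_cantor T id) => //; apply: sub => x _.
  move=> /existsNP/min[z nCz mz]; apply: nCz; apply/asboolP; apply: sub => x xz.
  by apply: contrapT => /mz.
Qed.

Lemma strict_well_order_least (W : eqType) (lt : W -> W -> Prop) (x : W) :
  strict_well_order lt -> exists o, forall y, ~ lt y o.
Proof.
move=> [_ _ _ wf]; have [|o _ mo] := @wf_min W lt wf (fun=> True); first by exists x.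
by exists o => y; apply: mo.
Qed.

(** Irreflexivity and transitivity follow, by taking least elements of sets of at most three
    vertices. *)
Definition well_ordered_graph (G : digraph) :=
  (forall x y, vertex G x -> vertex G y -> [\/ edge G x y, x = y | edge G y x]) /\
  (forall P : nat -> Prop, (exists2 x, vertex G x & P x) ->
    exists x, [/\ vertex G x, P x & forall y, vertex G y -> P y -> ~ edge G y x]).

(** A relation rather than a map, because matching equivalent tuples does not visibly produce a
    function. *)
Definition isomorphism_relation (G G' : digraph) (R : nat -> nat -> Prop) :=
  [/\ forall x, vertex G x -> exists2 x', vertex G' x' & R x x',
    forall x', vertex G' x' -> exists2 x, vertex G x & R x x' &
    forall x y x' y', R x x' -> R y y' -> edge G x y <-> edge G' x' y'].

(** The graphs are the segments below two multiples [e] and [e'] of omega ^ |r|, with [e] below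
    [e']. *)
Lemma equivalent_well_ordered_graphs (r : rank) : exists G G' T,
  [/\ well_ordered_graph G /\ well_ordered_graph G',
    system G G' T, system G' G (fun r a a' => T r a' a), T r [::] [::] &
    ~ exists R, isomorphism_relation G G' R].
Proof.
have [W [lt [wo cnt unc]]] := first_uncountable.
have [x] : exists x : W, True.
  apply: contrapT => nW; apply: unc; suff -> : [set: W]%classic = set0 by [].
  by apply/seteqP; split=> // x _; case: nW; exists x.
have [o mino _] := strict_well_order_least x wo.
have [irr trans total wf] := wo.
have [e oe Le] := exists_lim trans total wf cnt unc r o.
have [e' ee' Le'] := exists_lim trans total wf cnt unc r e.
have oe' := trans _ _ _ oe ee'.
have bel d : exists i, injective_below lt d i.
  have /countable_injP[i inji] := cnt d; exists i => v w vd wd.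
  by apply: inji; rewrite inE.
have [i inji] := bel e; have [i' inji'] := bel e'.
have wog d j : injective_below lt d j -> well_ordered_graph (segment trans d j).
  move=> injj; split=> [y z|P]; first exact: segment_total.
  exact: segment_min.
exists (segment trans e i), (segment trans e' i'), (segment_system lt o e e' i i').
split.
- by split; apply: wog.
- exact: segment_systemP.
- have [H1 H2 H3] := segment_systemP irr trans total wf mino inji' inji.
  split=> [s a a' /segment_system_swap-/H1//|f k a a'|f k a a' b].
    by move=> /segment_system_swap/H2/segment_system_swap.
  move=> /segment_system_swap/H3 H vb nb; have [b' /segment_system_swap] := H k b vb nb.
  by exists b'.
- exact: segment_system0.
- move=> [R [_ surj ER]]; exact: segment_rel_lt inji inji' ee' surj ER.
Qed.

(** * Lifting equivalences from G to L(G) *)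

(** States of an automaton reading a sequence of L(G): it expects some r_i, some q_i or the final
    number, or it has read a complete sequence, or it has failed. *)
Inductive tag := TagR | TagQ | TagK | TagDone | TagBad.

Section Lifting.
Variables (A : nat -> set rat) (t : nat -> atype) (col : rat -> nat).
Hypotheses (colP : forall n q, A n q <-> col q = n)
  (col_dense : forall n a b, (a < b)%R -> exists2 q, col q = n & (a < q < b)%R).

Definition parse_step (u : rat) (s : tag * seq nat) : tag * seq nat :=
  match s.1 with
  | TagR => (if col u == 0 then TagQ else if col u == 1 then TagK else TagBad, s.2)
  | TagQ => (TagR, col u :: s.2)
  | TagK => (TagDone, s.2)
  | _ => (TagBad, s.2)
  end.

(** Prefixes are reversed, so appending a letter is a cons, and labels come newest first as in a
    [system]. *)
Definition parse (p : seq rat) := foldr parse_step (TagR, [::]) p.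

Definition labels p := (parse p).2.

Lemma parse_cons u p : parse (u :: p) = parse_step u (parse p).
Proof. by []. Qed.

(** Membership in L(G) in terms of the tag, the labels and the last entry, which are the data that
    an equivalence of prefixes controls. *)
Definition FS_code (G : digraph) (x : seq rat) : Prop :=
  [/\ (parse (rev x)).1 = TagDone, uniq (labels (rev x)),
    forall a, a \in labels (rev x) -> vertex G a &
    exists m k, [/\ 0 < m, k < m, last 0%R x = k%:R%R, arity (t m) = size (labels (rev x)) &
      forall i j : 'I_(arity (t m)), diag (t m) i j <->
        edge G (nth 0 (rev (labels (rev x))) i) (nth 0 (rev (labels (rev x))) j)]].

Definition pairs (w : seq (rat * rat)) := flatten [seq [:: z.1; z.2] | z <- w].

Lemma parse_pairs w : (forall z, z \in w -> col z.1 = 0) ->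
  parse (rev (pairs w)) = (TagR, rev [seq col z.2 | z <- w]).
Proof.
elim/last_ind: w => // w z IH H.
rewrite /pairs map_rcons flatten_rcons rev_cat /=.
rewrite IH => [|y yw]; last by apply: H; rewrite mem_rcons inE yw orbT.
by rewrite /parse_step /= H ?mem_rcons ?mem_head //= map_rcons rev_rcons.
Qed.

Lemma pairs_parse p : (parse p).1 = TagR ->
  exists2 w, p = rev (pairs w) & forall z, z \in w -> col z.1 = 0.
Proof.
have [n] := ubnP (size p); elim: n p => // n IH [|q [|r p]].
- by exists [::].
- by rewrite /= /parse_step /=; case: ifP => // _; case: ifP.
rewrite !parse_cons /= !ltnS => sp.
rewrite {1}/parse_step {1}/parse_step; case E: (parse p).1 => //=;
  last by case: ifP => // _; case: ifP.
case: eqP => [cr|_]; last by case: ifP.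
move=> _; have [|w -> H] := IH p _ E; first exact: ltnW.
exists (rcons w (r, q)).
  by rewrite /pairs map_rcons flatten_rcons rev_cat.
by move=> z; rewrite mem_rcons inE => /predU1P[->|/H].
Qed.

Lemma map_nth_enum (T S : Type) (x0 : T) (f : T -> S) (w : seq T) n : n = size w ->
  [seq f (nth x0 w (val i)) | i <- enum 'I_n] = map f w.
Proof.
move=> ->; rewrite (map_comp (fun i => f (nth x0 w i)) val) val_enum_ord.
by rewrite (map_comp f) map_nth_iota0 ?take_size.
Qed.

Lemma FS_memP G x : FS_mem A t G x <-> FS_code G x.
Proof.
split=> [[m [a [q [r [rn [k [-> Hr Hrn Hq [m0 km inja va Ha]]]]]]]]|].
  set n := arity (t m) in a q r Hr Hq inja va Ha *.
  pose w := [seq (r i, q i) | i <- enum 'I_n].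
  have -> : flatten [seq [:: r i; q i] | i <- enum 'I_n] = pairs w.
    by rewrite /pairs /w -map_comp.
  have Ew : [seq col z.2 | z <- w] = [seq a i | i <- enum 'I_n].
    by rewrite /w -map_comp; apply: eq_map => i; apply/colP.
  have Ep : parse (rev (pairs w ++ [:: rn; k%:R%R])) = (TagDone, rev [seq a i | i <- enum 'I_n]).
    rewrite rev_cat /= parse_pairs ?Ew => [|z /mapP[i _ ->]];
      last by apply: (colP _ _).1; apply: Hr.
    by rewrite /parse_step /= ((colP _ _).1 Hrn).
  have Ea (i : 'I_n) : nth 0 [seq a i | i <- enum 'I_n] i = a i.
    by rewrite (nth_map i) ?size_enum_ord // nth_ord_enum.
  rewrite /FS_code /labels Ep /=; split=> //.
  + by rewrite rev_uniq map_inj_uniq ?enum_uniq.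
  + by move=> b; rewrite mem_rev => /mapP[i _ ->].
  + exists m, k; rewrite size_rev size_map size_enum_ord last_cat; split=> // i j.
    by rewrite revK !Ea.
have [y ->] : exists y, x = rev y by exists (rev x); rewrite revK.
rewrite /FS_code revK => -[D ua va [m [k [m0 km lx sa Ha]]]].
move: D ua va lx sa Ha; case: y => [//|k' [|rn p]].
  by rewrite /= /parse_step /=; case: ifP => // _; case: ifP.
rewrite /labels !parse_cons [parse_step k' _]/parse_step [parse_step rn _]/parse_step.
case E: (parse p).1 => //=; case: ifP => // cr0; case: ifP => // /eqP cr1 _.
have [w pw Hw] := pairs_parse E.
have -> : (parse p).2 = rev [seq col z.2 | z <- w] by rewrite pw parse_pairs.
rewrite revK rev_uniq size_rev size_map rev_cons last_rcons => uw vw kk' sw Ha.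
pose a (i : 'I_(arity (t m))) := nth 0 [seq col z.2 | z <- w] i.
have ltw (i : 'I_(arity (t m))) : i < size w by rewrite -sw.
have Ea i : a i = col (nth (0%R, 0%R) w i).2 by rewrite /a (nth_map (0%R, 0%R)).
exists m, a, (fun i => (nth (0%R, 0%R) w i).2), (fun i => (nth (0%R, 0%R) w i).1), rn, k.
split.
- rewrite (map_nth_enum (0%R, 0%R) (fun z => [:: z.1; z.2])) // pw.
  by rewrite -kk' !rev_cons revK -!cats1 -catA.
- by move=> i; apply/colP/Hw/mem_nth.
- exact/colP.
- by move=> i; apply/colP.
- split=> // [i j|i]; last by apply: vw; rewrite mem_rev mem_nth // size_map.
  by move/eqP; rewrite nth_uniq ?size_map // => /eqP/val_inj.
Qed.

Lemma cut_between (L H : seq rat) : (forall a b, a \in L -> b \in H -> (a < b)%R) ->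
  exists a b, [/\ (a < b)%R, forall x, x \in L -> (x <= a)%R & forall y, y \in H -> (b <= y)%R].
Proof.
move=> LH.
have [a [aL aH]] : exists a, (forall x, x \in L -> (x <= a)%R) /\ forall y, y \in H -> (a < y)%R.
  elim: L LH => [_|x L IH LH].
    elim: H => [|y H [a [_ aH]]]; first by exists 0%R.
    exists (Num.min a (y - 1)%R); split=> // z; rewrite inE => /predU1P[->|/aH az].
      by rewrite gt_min orbC ltrBlDr ltrDl ltr01.
    by rewrite gt_min az.
  have [|a [aL aH]] := IH; first by move=> u v uL; apply: LH; rewrite inE uL orbT.
  exists (Num.max a x); split=> [z|y yH].
    by rewrite inE le_max => /predU1P[->|/aL->//]; rewrite lexx orbT.
  by rewrite gt_max aH // LH // mem_head.
exists a; elim: H {LH} aH => [_|y H IH aH].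
  by exists (a + 1)%R; split=> //; rewrite ltrDl ltr01.
have [|b [ab _ bH]] := IH; first by move=> z zH; apply: aH; rewrite inE zH orbT.
exists (Num.min b y); split=> // [|z].
  by rewrite lt_min ab aH // mem_head.
by rewrite inE ge_min => /predU1P[->|/bH->//]; rewrite lexx orbT.
Qed.

(** The points of [C] leave an open interval for the image of [u], and every colour is dense
    there. *)
Lemma cut_color (C : seq (rat * rat)) u n :
    (forall c d, c \in C -> d \in C -> (c.1 < d.1)%R <-> (c.2 < d.2)%R) ->
    (forall c, c \in C -> c.1 <> u) ->
  exists2 u', col u' = n & forall c, c \in C ->
    ((u < c.1)%R <-> (u' < c.2)%R) /\ ((c.1 < u)%R <-> (c.2 < u')%R).
Proof.
move=> O nu.
have [|a [b [ab La Hb]]] := @cut_between [seq c.2 | c <- C & (c.1 < u)%R]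
    [seq c.2 | c <- C & (u < c.1)%R].
  move=> _ _ /mapP[c + ->] /mapP[d + ->]; rewrite !mem_filter.
  by move=> /andP[cu cC] /andP[ud dC]; apply/O => //; apply: lt_trans ud.
have [u' cu' /andP[au ub]] := col_dense n ab; exists u' => // c cC.
have [cu|uc|/(nu c cC)//] := ltgtP c.1 u.
  have ca : (c.2 <= a)%R by apply/La/map_f; rewrite mem_filter cu.
  have cu1 := le_lt_trans ca au.
  by split; split=> // /(lt_trans cu1); rewrite ltxx.
have bc : (b <= c.2)%R by apply/Hb/map_f; rewrite mem_filter uc.
have uc1 := lt_le_trans ub bc.
by split; split=> // /(lt_trans uc1); rewrite ltxx.
Qed.

(** * Equivalence of prefixes *)

Section PrefixEquivalence.
Variable T : rank -> seq nat -> seq nat -> Prop.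

(* Prefixes are reversed, so that [u :: p] is the prefix [rev p] followed by [u]. *)
Fixpoint prefix_eqv (r : rank) (p p' : seq rat) : Prop :=
  match p, p' with
  | [::], [::] => T r [::] [::]
  | u :: q, u' :: q' =>
      [/\ prefix_eqv r q q', (parse p).1 = (parse p').1, (parse p).1 <> TagBad,
        T r (labels p) (labels p') & (parse q).1 = TagK -> u = u']
  | _, _ => False
  end.

Lemma prefix_eqv_cons r u q u' q' :
  [/\ prefix_eqv r q q', (parse (u :: q)).1 = (parse (u' :: q')).1,
     (parse (u :: q)).1 <> TagBad, T r (labels (u :: q)) (labels (u' :: q')) &
     (parse q).1 = TagK -> u = u'] -> prefix_eqv r (u :: q) (u' :: q').
Proof. by []. Qed.

Lemma prefix_eqv_size r p p' : prefix_eqv r p p' -> size p = size p'.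
Proof. by elim: p p' => [|u p IH] [|u' p'] //= [/IH->]. Qed.

Lemma prefix_eqv_labels r p p' : prefix_eqv r p p' -> T r (labels p) (labels p').
Proof. by case: p p' => [|u p] [|u' p'] //= []. Qed.

Lemma prefix_eqv_tag r p p' : prefix_eqv r p p' -> (parse p).1 = (parse p').1.
Proof. by case: p p' => [|u p] [|u' p'] //= []. Qed.

Lemma prefix_eqv_drop r p p' n : prefix_eqv r p p' -> prefix_eqv r (drop n p) (drop n p').
Proof. by elim: n p p' => [|n IH] [|u p] [|u' p'] //= []; auto. Qed.

Lemma prefix_eqv_take r x x' n :
  prefix_eqv r (rev x) (rev x') -> prefix_eqv r (rev (take n x)) (rev (take n x')).
Proof.
move=> H; have := prefix_eqv_size H; rewrite !size_rev => E.
have [nx|/ltnW xn] := leqP n (size x); last by rewrite !take_oversize -?E.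
have := prefix_eqv_drop (size x - n) H.
by rewrite !drop_rev {3}E !subKn -?E.
Qed.

Hypothesis T_mono : forall f k a a', T (RankS f) a a' -> T (f k) a a'.

Lemma prefix_eqv_mono f k p p' : prefix_eqv (RankS f) p p' -> prefix_eqv (f k) p p'.
Proof.
elim: p p' => [|u p IH] [|u' p'] //=; first exact: T_mono.
by move=> [/IH ? ? ? ? ?]; split=> //; apply: T_mono.
Qed.

End PrefixEquivalence.

Lemma prefix_eqv_swap T r p p' :
  prefix_eqv T r p p' -> prefix_eqv (fun r a a' => T r a' a) r p' p.
Proof.
elim: p p' => [|u p IH] [|u' p'] //= [H E nB TT K]; split=> //; first exact: IH.
  by rewrite -E.
by rewrite -(prefix_eqv_tag H) => /K.
Qed.

(* Each move in L(G) names finitely many vertices of G, so one step of rank has to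
   be replaced by arbitrarily many. *)
Fixpoint om (r : rank) : rank :=
  match r with
  | Rank0 => Rank0
  | RankS f => RankS (fun n => RankS (fun k => iter n rank_succ (om (f k))))
  end.

(** * Equivalence of tuples of L(G) *)

Definition same_order (a b a' b' : rat) :=
  ((a < b)%R <-> (a' < b')%R) /\ ((b < a)%R <-> (b' < a')%R).

(** In the tree of prefixes, the two left sequences and the two right ones branch at the same level
    and in the same direction. *)
Definition same_position (z w : seq rat * seq rat) := forall l,
  (take l z.1 = take l w.1 <-> take l z.2 = take l w.2) /\
  (take l z.1 = take l w.1 -> l < size z.1 -> l < size w.1 ->
    same_order (nth 0%R z.1 l) (nth 0%R w.1 l) (nth 0%R z.2 l) (nth 0%R w.2 l)).

Lemma same_positionC z w : same_position z w -> same_position w z.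
Proof.
move=> H l; have [[H1 H2] H3] := H l; split; first by split=> /esym; [move/H1|move/H2].
by move=> /esym E lw lz; have [] := H3 E lz lw.
Qed.

Lemma same_position_refl x x' : same_position (x, x') (x, x').
Proof. by move=> l; split=> // _ _ _; split; rewrite !ltxx. Qed.

Lemma take_eqS (x y : seq rat) l : l < size x -> take l.+1 x = take l.+1 y ->
  [/\ l < size y, take l x = take l y & nth 0%R x l = nth 0%R y l].
Proof.
move=> lx E; have ly : l < size y.
  have := congr1 size E; rewrite (size_takel lx) => /esym.
  by rewrite size_take; case: ltnP => [/ltnW|_ ->].
split=> //; first by rewrite -(take_takel x (leqnSn l)) E take_takel.
by rewrite -(nth_take 0%R (ltnSn l)) E nth_take.
Qed.

Lemma take_eq_oversize (x y : seq rat) l : size x < l ->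
  take l x = take l y <-> take (size x) x = take (size x) y /\ size y <= size x.
Proof.
move=> xl; split=> [E|[E yx]].
  split; first by rewrite -(take_takel x (ltnW xl)) E take_takel // ltnW.
  have := congr1 size E; rewrite (take_oversize (ltnW xl)) => /esym.
  rewrite size_take; case: ltnP => [_ e|_ -> //]; by rewrite e ltnn in xl.
by move: E; rewrite !take_oversize // ?(ltnW xl) // (leq_trans yx) // ltnW.
Qed.

(** At level [l] the sequence [x] either ends or leaves [w.1], and its partner does likewise with
    [w.2]; so the comparison at higher levels is settled by levels up to [l]. *)
Lemma same_position_intro l x x' (w : seq rat * seq rat) :
    l <= size x -> size x = size x' -> size w.1 = size w.2 ->
    (forall l', l' <= l -> take l' x = take l' w.1 <-> take l' x' = take l' w.2) ->
    (forall l', l' < l -> take l' x = take l' w.1 -> l' < size w.1 ->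
      same_order (nth 0%R x l') (nth 0%R w.1 l') (nth 0%R x' l') (nth 0%R w.2 l')) ->
    (l < size x -> take l x = take l w.1 -> l < size w.1 ->
      nth 0%R x l <> nth 0%R w.1 l /\
      same_order (nth 0%R x l) (nth 0%R w.1 l) (nth 0%R x' l) (nth 0%R w.2 l)) ->
  same_position (x, x') w.
Proof.
move=> lx Ex Ew H1 H2 H3 l'; have [l'l|ll'|->] /= := ltngtP l' l.
- by split=> [|E _ lw]; [apply/H1/ltnW|apply: H2].
- have [xl|l_x] := leqP (size x) l.
    have lE : l = size x by apply/eqP; rewrite eqn_leq lx.
    rewrite lE in ll' H1; split=> [|_ lx']; last first.
      by move: (ltn_trans ll' lx'); rewrite ltnn.
    have ll2 : size x' < l' by rewrite -Ex.
    by rewrite (take_eq_oversize w.1 ll') (take_eq_oversize w.2 ll2) -Ex -Ew H1.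
  have n1 : take l' x <> take l' w.1.
    move=> /(congr1 (take l.+1)); rewrite !take_takel // => /(take_eqS l_x)[lw E En].
    by have [] := H3 l_x E lw.
  have n2 : take l' x' <> take l' w.2.
    move=> /(congr1 (take l.+1)); rewrite !take_takel // => E.
    have [|lw {}E En] := take_eqS _ E; first by rewrite -Ex.
    have {}E := (H1 l (leqnn l)).2 E.
    have [|nE [O1 O2]] := H3 l_x E; first by rewrite Ew.
    have [/O1|/O2|//] := ltgtP (nth 0%R x l) (nth 0%R w.1 l); by rewrite En ltxx.
  by split=> [|/n1//]; split=> [/n1|/n2].
- by split=> [|E l_x lw]; [apply: H1|have [] := H3 l_x E lw].
Qed.

Definition tuple_eqv T (r : rank) (zs : seq (seq rat * seq rat)) :=
  [/\ T (om r) [::] [::],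
    forall z, z \in zs -> prefix_eqv T (om r) (rev z.1) (rev z.2) &
    forall z w, z \in zs -> w \in zs -> same_position z w].

Section Systems.
Variables (G G' : digraph) (T : rank -> seq nat -> seq nat -> Prop).
Hypothesis sT : system G G' T.

Let T_mono := system_mono sT.

Definition valid_prefix p :=
  [/\ (parse p).1 <> TagBad, uniq (labels p) & forall a, a \in labels p -> vertex G a].

Lemma valid_prefix_cons u p : valid_prefix (u :: p) -> valid_prefix p.
Proof.
rewrite /valid_prefix /labels parse_cons /parse_step.
case: (parse p) => -[] a //= [nB ua va]; split=> //; first by case/andP: ua.
by move=> b ba; apply: va; rewrite inE ba orbT.
Qed.

Lemma valid_prefix_cat q p : valid_prefix (q ++ p) -> valid_prefix p.
Proof. by elim: q => // u q IH /valid_prefix_cons. Qed.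

(** The answer depends on the state: an r_i is answered with the same colour, a q_i with a colour
    obtained from a move in the graphs, and the final number with itself. [C] lists the competing
    letters at the same node and their images. *)
Lemma prefix_eqv_step f k p p' u (C : seq (rat * rat)) :
    prefix_eqv T (RankS f) p p' -> valid_prefix (u :: p) ->
    (forall c d, c \in C -> d \in C -> (c.1 < d.1)%R <-> (c.2 < d.2)%R) ->
    (forall c, c \in C -> c.1 <> u) ->
    ((parse p).1 = TagK -> forall c, c \in C -> c.1 = c.2) ->
  exists2 u', prefix_eqv T (f k) (u :: p) (u' :: p') & forall c, c \in C ->
    ((u < c.1)%R <-> (u' < c.2)%R) /\ ((c.1 < u)%R <-> (c.2 < u')%R).
Proof.
move=> H vu O nu CK; have HT := prefix_eqv_labels H; have Etag := prefix_eqv_tag H.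
have Hk := prefix_eqv_mono T_mono k H; have HTk := T_mono k HT.
have step v : parse_step v (parse p') = parse_step v ((parse p).1, labels p').
  by rewrite Etag -surjective_pairing.
have pp : parse p = ((parse p).1, labels p) by rewrite -surjective_pairing.
rewrite /valid_prefix /labels parse_cons pp in vu.
case E: (parse p).1 vu => -[nB uu vu]; do ?by case: nB.
- have [u' cu' Hu'] := cut_color (col u) O nu.
  by exists u' => //; apply: prefix_eqv_cons;
    rewrite /labels !parse_cons step pp E /parse_step /= cu'.
- move: uu => /= /andP[nu' _].
  have [|b' Tb] := system_forth sT k HT _ nu'; first by apply: vu; rewrite mem_head.
  have [u' cu' Hu'] := cut_color b' O nu.
  by exists u' => //; apply: prefix_eqv_cons;
    rewrite /labels !parse_cons step pp E /parse_step /= cu'.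
- exists u => [|c cC]; last by rewrite (CK E c cC).
  by apply: prefix_eqv_cons; rewrite /labels !parse_cons step pp E.
Qed.

Lemma prefix_eqv_extend s w p p' :
    prefix_eqv T (iter (size w) rank_succ s) p p' -> valid_prefix (w ++ p) ->
  exists w', prefix_eqv T s (w ++ p) (w' ++ p').
Proof.
elim: w s => [|u w IH] s /=; first by exists [::].
move=> H vw; have [|w' Hw'] := IH (rank_succ s) _ (valid_prefix_cons vw).
  by rewrite -iterSr.
have [//|//|//|u' Hu' _] := prefix_eqv_step (C := [::]) 0 Hw' vw.
by exists (u' :: w').
Qed.

Lemma FS_code_eqv r x x' :
  prefix_eqv T r (rev x) (rev x') -> FS_code G x -> FS_code G' x'.
Proof.
move=> H [D ux vx [m [k [m0 km lx sx Ha]]]].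
have Etag := prefix_eqv_tag H.
have [sa [ua ua'] va va' Ea] := system_atom sT (prefix_eqv_labels H).
split=> //; first by rewrite -Etag.
exists m, k; split=> //; [| |].
- move: lx D H; rewrite -(revK x) -(revK x').
  case: (rev x) (rev x') => [|u p] [|u' p'] //; first by rewrite !revK => _ _ [].
  rewrite !revK !rev_cons !last_rcons.
  move=> -> D [_ _ _ _ <-] //; move: D; rewrite parse_cons /parse_step.
  by case: (parse p).1 => //; case: ifP => // _; case: ifP.
- by rewrite sx.
- move=> i j; rewrite Ha; set a := labels (rev x) in sx sa Ea *.
  have li (h : 'I_(arity (t m))) : size a - h.+1 < size a.
    by rewrite ltn_subrL /= -sx (leq_ltn_trans _ (ltn_ord h)).
  have la (h : 'I_(arity (t m))) : h < size a by rewrite -sx.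
  by rewrite !nth_rev -?sa //; apply: Ea.
Qed.

Lemma om_mono f k a a' : T (om (RankS f)) a a' -> T (om (f k)) a a'.
Proof. by move=> /= /(T_mono 0)/(T_mono k). Qed.

Lemma prefix_eqv_om_mono f k p p' :
  prefix_eqv T (om (RankS f)) p p' -> prefix_eqv T (om (f k)) p p'.
Proof. by move=> /= /(prefix_eqv_mono T_mono 0)/(prefix_eqv_mono T_mono k). Qed.

Lemma tuple_eqv_mono f k zs : tuple_eqv T (RankS f) zs -> tuple_eqv T (f k) zs.
Proof.
move=> [H0 H1 H2]; split=> //; first exact: om_mono.
by move=> z /H1; apply: prefix_eqv_om_mono.
Qed.

(** [p] is the part of [x] shared with earlier sequences. Only the first letter after it must
    respect the order against [C]; the later letters are unconstrained by other sequences. *)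
Lemma prefix_eqv_fork f k p p' x (C : seq (rat * rat)) :
    prefix_eqv T (om (RankS f)) (rev p) (rev p') ->
    valid_prefix (rev x) -> take (size p) x = p ->
    (size p < size x -> [/\
      forall c d, c \in C -> d \in C -> (c.1 < d.1)%R <-> (c.2 < d.2)%R,
      forall c, c \in C -> c.1 <> nth 0%R x (size p) &
      (parse (rev p)).1 = TagK -> forall c, c \in C -> c.1 = c.2]) ->
  exists w', let x' := p' ++ w' in prefix_eqv T (om (f k)) (rev x) (rev x') /\
    (size p < size x -> forall c, c \in C ->
      same_order (nth 0%R x (size p)) c.1 (nth 0%R x' (size p)) c.2).
Proof.
move=> H vx px HC; have sp := prefix_eqv_size H; rewrite !size_rev in sp.
have [xp|lx] := leqP (size x) (size p).
  exists [::]; rewrite cats0; split=> //.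
  by rewrite -px take_oversize // in H; apply: prefix_eqv_om_mono.
have [O nu CK] := HC lx.
have Ex : x = rcons p (nth 0%R x (size p)) ++ drop (size p).+1 x.
  by rewrite -{1}(cat_take_drop (size p).+1 x) (take_nth 0%R lx) px.
set u := nth 0%R x (size p) in Ex nu *; set s := drop _ x in Ex.
have Erx : rev x = rev s ++ u :: rev p by rewrite Ex rev_cat rev_rcons.
rewrite Erx in vx *.
(* The first step of [om] announces the number of letters after the fork; the second pays for the
   forking letter. *)
have /= Hs := prefix_eqv_mono T_mono (size s) H.
have [u' Hu' uC] := prefix_eqv_step k Hs (valid_prefix_cat vx) O nu CK.
have [|w' Hw'] := prefix_eqv_extend (s := om (f k)) (w := rev s) _ vx (p' := u' :: rev p').
  by rewrite size_rev.
exists (u' :: rev w'); split; first by rewrite rev_cat rev_cons revK cat_rcons.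
by move=> _ c cC; rewrite nth_cat sp ltnn subnn; apply: uC.
Qed.

Lemma FS_code_valid x : FS_code G x -> valid_prefix (rev x).
Proof. by move=> [D ux vx _]; split=> //; rewrite D. Qed.

(** Let [l] be the length of the longest prefix of [x] shared with an earlier sequence. Its image
    [q] is inherited from that sequence, and the rest of [x] is answered by [prefix_eqv_fork]. *)
Lemma tuple_eqv_forth f k zs x : tuple_eqv T (RankS f) zs -> FS_code G x ->
  exists2 x', FS_code G' x' & tuple_eqv T (f k) ((x, x') :: zs).
Proof.
move=> Hzs Fx; have [H0 H1 H2] := Hzs.
have szs w : w \in zs -> size w.1 = size w.2.
  by move=> /H1/prefix_eqv_size; rewrite !size_rev.
pose P l := (l <= size x) && ((l == 0) || has (fun z => take l z.1 == take l x) zs).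
have exP : exists l, P l by exists 0.
have [l /andP[lx Pl] maxl] := ex_maxnP exP (fun l Pl => proj1 (andP Pl)).
have [q [sq Hq posq ordq]] : exists q, [/\ size q = l,
    prefix_eqv T (om (RankS f)) (rev (take l x)) (rev q),
    forall w, w \in zs -> forall l', l' <= l ->
      take l' x = take l' w.1 <-> take l' q = take l' w.2 &
    forall w, w \in zs -> forall l', l' < l -> take l' x = take l' w.1 -> l' < size w.1 ->
      same_order (nth 0%R x l') (nth 0%R w.1 l') (nth 0%R q l') (nth 0%R w.2 l')].
  case/orP: Pl => [/eqP-> |/hasP[z zzs /eqP zx]].
    exists [::]; split=> //; first by rewrite take0.
    by move=> w _ l'; rewrite leqn0 => /eqP->; rewrite !take0.
  have lz : l <= size z.1.
    rewrite leqNgt; apply/negP => zl; have := congr1 size zx.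
    by rewrite (size_takel lx) take_oversize ?(ltnW zl) // => e; rewrite e ltnn in zl.
  have Et l' : l' <= l -> take l' x = take l' z.1.
    by move=> l'l; rewrite -(take_takel x l'l) -zx take_takel.
  exists (take l z.2); split.
  - by rewrite size_takel // -szs.
  - by rewrite -zx; apply/prefix_eqv_take/H1.
  - by move=> w wzs l' l'l; rewrite Et // take_takel //; have [] := H2 z w zzs wzs l'.
  - move=> w wzs l' l'l E lw; rewrite (nth_take _ l'l).
    have -> : nth 0%R x l' = nth 0%R z.1 l'.
      by rewrite -(nth_take _ l'l) -zx nth_take.
    have [_] := H2 z w zzs wzs l'; apply=> //; first by rewrite -Et // ltnW.
    exact: leq_trans lz.
(* The letters by which earlier sequences continue at the fork; by maximality of [l] the letter of
   [x] is not among them. *)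
pose C := [seq (nth 0%R w.1 l, nth 0%R w.2 l) |
            w <- zs & (take l w.1 == take l x) && (l < size w.1)].
have CP c : c \in C -> exists2 w, [/\ w \in zs, take l w.1 = take l x & l < size w.1] &
    c = (nth 0%R w.1 l, nth 0%R w.2 l).
  by case/mapP=> w; rewrite mem_filter => /andP[/andP[/eqP ? ?] ?] ->; exists w.
have sl : size (take l x) = l by rewrite size_takel.
have nthC w : l < size x -> w \in zs -> take l w.1 = take l x -> l < size w.1 ->
    nth 0%R w.1 l <> nth 0%R x l.
  move=> l_x wzs E lw En; suff /maxl : P l.+1 by rewrite ltnn.
  apply/andP; split=> //; apply/orP; right; apply/hasP; exists w => //.
  by rewrite !(take_nth 0%R) // E En.
have [||w' [Hx' Cx']] := prefix_eqv_fork k (x := x) (C := C) Hq (FS_code_valid Fx).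
- by rewrite sl.
- rewrite sl => l_x; split.
  + move=> _ _ /CP[w [wzs Ew lw] ->] /CP[v [vzs Ev lv] ->] /=.
    by have [_ H] := H2 w v wzs vzs l; have [] := H _ lw lv; rewrite ?Ew ?Ev.
  + by move=> _ /CP[w [wzs Ew lw] ->]; apply: nthC => //; rewrite -sl.
  + move=> K _ /CP[w [wzs Ew lw] ->] /=.
    have := prefix_eqv_take l.+1 (H1 w wzs).
    rewrite !(take_nth 0%R) -?szs // !rev_rcons Ew => -[_ _ _ _]; exact.
set x' := q ++ w' in Hx' Cx'; rewrite sl in Cx'.
have sx' : size x = size x' by have := prefix_eqv_size Hx'; rewrite !size_rev.
exists x'; first exact: FS_code_eqv Hx' Fx.
have new w : w \in zs -> same_position (x, x') w.
  move=> wzs; apply: (same_position_intro (l := l)) => //.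
  - exact: szs.
  - by move=> l' l'l; rewrite posq // takel_cat // sq.
  - by move=> l' l'l E lw; rewrite nth_cat sq l'l; apply: ordq.
  - move=> l_x E lw; split; first by apply/nesym/nthC.
    apply: (Cx' l_x (_, _)); apply/mapP; exists w => //.
    by rewrite mem_filter -E eqxx lw.
have [H0' H1' _] := tuple_eqv_mono k Hzs.
split=> // [z|z w]; rewrite !inE; first by move=> /predU1P[->|/H1'].
move=> /predU1P[->|zzs] /predU1P[->|wzs].
- exact: same_position_refl.
- exact: new.
- exact/same_positionC/new.
- exact: H2.
Qed.

End Systems.

(** This puts the order in terms of the level of branching, which [same_position] preserves; the
    case l = size x is that of a proper prefix. *)
Lemma lexi_take (x y : seq rat) : ((x : seqlexi rat) < y)%O <->
  exists l, [/\ take l x = take l y, l <= size x, l < size y &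
    l < size x -> (nth 0%R x l < nth 0%R y l)%R].
Proof.
elim: x y => [|a x IH] [|b y].
- by split=> // -[l []].
- by split=> // _; exists 0; split=> //=; rewrite take0.
- by split=> // -[l []].
have [ab|ba|->] := ltgtP a b.
- rewrite neqhead_ltxiE ?lt_eqF //; split=> // _; exists 0; split=> //.
- rewrite neqhead_ltxiE ?gt_eqF // [X in is_true X](_ : _ = false) ?ltNge ?ltW //.
  split=> // -[[|l] [E _ _]]; first by move/(_ isT); rewrite /= ltNge ltW.
  by case: E ba => ->; rewrite ltxx.
- rewrite eqhead_ltxiE IH; split=> [[l [E lx ly H]]|[[|l] [E lx ly H]]].
  + by exists l.+1; split=> //=; rewrite E.
  + by have := H isT; rewrite /= ltxx.
  + by exists l; case: E => E; split.
Qed.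

Lemma tuple_eqv_lt T r zs z w : tuple_eqv T r zs -> z \in zs -> w \in zs ->
  ((z.1 : seqlexi rat) < w.1)%O <-> ((z.2 : seqlexi rat) < w.2)%O.
Proof.
move=> [_ H1 H2] zzs wzs.
have sz v : v \in zs -> size v.1 = size v.2.
  by move=> /H1/prefix_eqv_size; rewrite !size_rev.
rewrite !lexi_take -!sz //; split=> -[l [E lz lw H]]; exists l;
  have [Et O] := H2 z w zzs wzs l; have {}E := E.
  by split=> // [|lz']; [apply/Et|apply/(O E lz' lw).1/H].
have E1 := Et.2 E; by split=> // lz'; apply/(O E1 lz' lw).1/H.
Qed.

Lemma tuple_eqv_eq T r zs z w : tuple_eqv T r zs -> z \in zs -> w \in zs ->
  z.1 = w.1 <-> z.2 = w.2.
Proof.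
move=> [_ H1 H2] zzs wzs.
have sz v : v \in zs -> size v.1 = size v.2.
  by move=> /H1/prefix_eqv_size; rewrite !size_rev.
have [] := H2 z w zzs wzs (maxn (size z.1) (size w.1)).
by rewrite !take_oversize -?sz // ?leq_maxl ?leq_maxr.
Qed.

Lemma tuple_eqv_swap T r zs :
  tuple_eqv T r zs -> tuple_eqv (fun r a a' => T r a' a) r (map swap zs).
Proof.
move=> [H0 H1 H2].
have sz v : v \in zs -> size v.1 = size v.2.
  by move=> /H1/prefix_eqv_size; rewrite !size_rev.
split=> // [_ /mapP[z zzs ->]|_ _ /mapP[z zzs ->] /mapP[w wzs ->] l /=].
  exact/prefix_eqv_swap/H1.
have [E O] := H2 z w zzs wzs l; split; first exact: iff_sym.
move=> /E/O {}O; rewrite -!sz // => lz lw; have [O1 O2] := O lz lw.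
by split; apply: iff_sym.
Qed.

Lemma sub_tuple_eqv T r zs zs' :
  {subset zs <= zs'} -> tuple_eqv T r zs' -> tuple_eqv T r zs.
Proof. by move=> S [H0 H1 H2]; split=> // [z /S|z w /S + /S]; auto. Qed.

Lemma map_swap_zip (S1 S2 : Type) (s1 : seq S1) (s2 : seq S2) :
  map swap (zip s1 s2) = zip s2 s1.
Proof. by elim: s1 s2 => [|a s1 IH] [|b s2] //=; rewrite IH. Qed.

(** * Invariance of infinitary formulas *)

Fixpoint quantifier_rank n (phi : formula n) : rank :=
  match phi with
  | FLt _ _ _ | FEq _ _ _ => Rank0
  | FNot _ psi => quantifier_rank psi
  | FAnd _ psi | FOr _ psi => RankS (fun k => quantifier_rank (psi k))
  | FEx _ psi | FAll _ psi => rank_succ (quantifier_rank psi)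
  end.

Definition FS_tuple G (v : seq (FS_type A t G)) : seq (seq rat) := [seq sval x | x <- v].

Lemma FS_type_inj G (x y : FS_type A t G) : sval x = sval y -> x = y.
Proof.
by case: x y => [x Fx] [y Fy] /= E; subst y; rewrite (Prop_irrelevance Fx Fy).
Qed.

Lemma FS_tupleP G (v : seq (FS_type A t G)) y : y \in FS_tuple v ->
  exists x : FS_type A t G, y = sval x.
Proof.
by elim: v => //= x v IH; rewrite inE => /predU1P[->|/IH//]; exists x.
Qed.

Section Formulas.
Variables (G G' : digraph) (T : rank -> seq nat -> seq nat -> Prop).
Hypotheses (sT : system G G' T) (sT' : system G' G (fun r a a' => T r a' a)).

Definition FS_eqv r (v : seq (FS_type A t G)) (v' : seq (FS_type A t G')) :=
  tuple_eqv T r (zip (FS_tuple v) (FS_tuple v')).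

Lemma FS_eqv_forth f k v v' x : FS_eqv (RankS f) v v' ->
  exists x', FS_eqv (f k) (x :: v) (x' :: v').
Proof.
move=> H; have [x' Fx' H'] := tuple_eqv_forth sT k H ((FS_memP _ _).1 (svalP x)).
by exists (exist _ x' ((FS_memP _ _).2 Fx')).
Qed.

Lemma FS_eqv_back f k v v' x' : FS_eqv (RankS f) v v' ->
  exists x, FS_eqv (f k) (x :: v) (x' :: v').
Proof.
move=> /tuple_eqv_swap H.
have [x Fx H'] := tuple_eqv_forth sT' k H ((FS_memP _ _).1 (svalP x')).
exists (exist _ x ((FS_memP _ _).2 Fx)).
by have := tuple_eqv_swap H'; rewrite /= mapK; last exact: swapK.
Qed.

Lemma FS_eqv_mono f k v v' : FS_eqv (RankS f) v v' -> FS_eqv (f k) v v'.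
Proof. by move=> H; apply: tuple_eqv_mono sT _ _ _ H. Qed.

Lemma mem_zip_tnth n (v : n.-tuple (FS_type A t G)) (v' : n.-tuple (FS_type A t G')) i :
  (sval (tnth v i), sval (tnth v' i)) \in zip (FS_tuple v) (FS_tuple v').
Proof.
have -> : (sval (tnth v i), sval (tnth v' i)) =
    nth ([::], [::]) (zip (FS_tuple v) (FS_tuple v')) i.
  rewrite nth_zip ?size_map ?size_tuple // !(nth_map (tnth v i)) ?size_tuple //.
  by rewrite !(nth_map (tnth v' i)) ?size_tuple // -!tnth_nth.
by rewrite mem_nth // size_zip !size_map !size_tuple minnn.
Qed.

Lemma sat_FS_eqv n (phi : formula n) (v : n.-tuple (FS_type A t G))
    (v' : n.-tuple (FS_type A t G')) : FS_eqv (quantifier_rank phi) v v' ->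
  sat (@FS_lt A t G) phi v <-> sat (@FS_lt A t G') phi v'.
Proof.
elim: phi v v' => {n} /= [n i j|n i j|n phi IH|n phi IH|n phi IH|n phi IH|n phi IH] v v' H.
- exact: tuple_eqv_lt H (mem_zip_tnth v v' i) (mem_zip_tnth v v' j).
- have E := tuple_eqv_eq H (mem_zip_tnth v v' i) (mem_zip_tnth v v' j).
  by split=> e; apply: FS_type_inj; apply/E; rewrite /= e.
- by rewrite (IH v v' H).
- have {}IH k := IH k _ _ (FS_eqv_mono k H).
  by split=> S k; apply/IH.
- have {}IH k := IH k _ _ (FS_eqv_mono k H).
  by split=> -[k S]; exists k; apply/IH.
- split=> -[x S].
    by have [x' /(IH [tuple of x :: v] [tuple of x' :: v']) H'] := FS_eqv_forth 0 x H;
      exists x'; apply/H'.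
  by have [x' /(IH [tuple of x' :: v] [tuple of x :: v']) H'] := FS_eqv_back 0 x H;
      exists x'; apply/H'.
- split=> S x.
    by have [x' /(IH [tuple of x' :: v] [tuple of x :: v']) H'] := FS_eqv_back 0 x H;
      apply/H'.
  by have [x' /(IH [tuple of x :: v] [tuple of x' :: v']) H'] := FS_eqv_forth 0 x H;
      apply/H'.
Qed.

End Formulas.

(** * Independent copies *)

Lemma prefix_eqv_comp T1 T2 T3 r1 r2 r3 p p' p'' :
  (forall a b c, T1 r1 a b -> T2 r2 b c -> T3 r3 a c) ->
  prefix_eqv T1 r1 p p' -> prefix_eqv T2 r2 p' p'' -> prefix_eqv T3 r3 p p''.
Proof.
move=> H; elim: p p' p'' => [|u p IH] [|u' p'] [|u'' p''] //=; first exact: H.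
move=> [H1 E1 n1 L1 K1] [H2 E2 n2 L2 K2]; split=> //.
- exact: IH H2.
- by rewrite E1.
- exact: H L2.
- by move=> K; rewrite K1 // K2 // -(prefix_eqv_tag H1).
Qed.

Lemma tuple_eqv_zipP T r s s' : size s = size s' -> tuple_eqv T r (zip s s') <->
  [/\ T (om r) [::] [::],
    forall i, i < size s -> prefix_eqv T (om r) (rev (nth [::] s i)) (rev (nth [::] s' i)) &
    forall i j, i < size s -> j < size s ->
      same_position (nth [::] s i, nth [::] s' i) (nth [::] s j, nth [::] s' j)].
Proof.
move=> ss; have sz : size (zip s s') = size s by rewrite size_zip ss minnn.
have zipN i : nth ([::], [::]) (zip s s') i = (nth [::] s i, nth [::] s' i).
  exact: nth_zip.
split=> -[H0 H1 H2]; split=> //;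
  [move=> i li|move=> i j li lj|move=> z /nthP|move=> z w /nthP + /nthP].
- have /H1 : nth ([::], [::]) (zip s s') i \in zip s s' by rewrite mem_nth ?sz.
  by rewrite zipN.
- have := H2 (nth ([::], [::]) (zip s s') i) (nth ([::], [::]) (zip s s') j).
  by rewrite !zipN; apply; rewrite -zipN mem_nth ?sz.
- by move=> /(_ ([::], [::]))[i li <-]; rewrite zipN; apply: H1; rewrite -sz.
- move=> /(_ ([::], [::]))[i li <-] /(_ ([::], [::]))[j lj <-].
  by rewrite !zipN; apply: H2; rewrite -sz.
Qed.

Lemma same_position_trans a b c d e f : size a = size b -> size d = size e ->
  same_position (a, b) (d, e) -> same_position (b, c) (e, f) ->
  same_position (a, c) (d, f).
Proof.
move=> ab de H1 H2 l; have [E1 O1] := H1 l; have [E2 O2] := H2 l.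
split; first exact: iff_trans E2.
move=> /= E la ld; have [P1 P2] := O1 E la ld.
have [||Q1 Q2] := O2 (E1.1 E); [by rewrite -ab|by rewrite -de|].
by split; [apply: iff_trans Q1|apply: iff_trans Q2].
Qed.

Lemma tuple_eqv_comp T1 T2 T3 r1 r2 r3 s s' s'' :
    (forall a b c, T1 (om r1) a b -> T2 (om r2) b c -> T3 (om r3) a c) ->
    size s = size s' -> size s' = size s'' ->
    tuple_eqv T1 r1 (zip s s') -> tuple_eqv T2 r2 (zip s' s'') ->
  tuple_eqv T3 r3 (zip s s'').
Proof.
move=> HT ss ss'; rewrite !tuple_eqv_zipP ?ss // -ss.
move=> [H0 H1 H2] [K0 K1 K2]; split=> [|i li|i j li lj].
- exact: HT K0.
- exact: prefix_eqv_comp HT (H1 i li) (K1 i li).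
- have sz h : h < size s -> size (nth [::] s h) = size (nth [::] s' h).
    by move=> /H1/prefix_eqv_size; rewrite !size_rev.
  by apply: same_position_trans (H2 i j li lj) (K2 i j li lj); apply: sz.
Qed.

(** Separation already at the first letter: only the empty prefix is shared across the two
    tuples. *)
Definition precedes (s s' : seq (seq rat)) :=
  forall x y, x \in s -> y \in s' -> (nth 0%R x 0 < nth 0%R y 0)%R.

Lemma same_position_precedes (z w : seq rat * seq rat) :
  (nth 0%R z.1 0 < nth 0%R w.1 0)%R -> (nth 0%R z.2 0 < nth 0%R w.2 0)%R ->
  same_position z w.
Proof.
move=> H1 H2 [|l].
  rewrite !take0; split=> // _ _ _; split; first by [].
  by split=> H; [have := lt_trans H1 H|have := lt_trans H2 H]; rewrite ltxx.
have neq (x y : seq rat) : (nth 0%R x 0 < nth 0%R y 0)%R -> take l.+1 x <> take l.+1 y.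
  by move=> + /(congr1 (fun s => nth 0%R s 0)); rewrite !nth_take // => + E; rewrite E ltxx.
by split=> [|/neq//]; split=> /neq.
Qed.

Lemma mem_zip (S1 S2 : eqType) (s1 : seq S1) (s2 : seq S2) z :
  z \in zip s1 s2 -> z.1 \in s1 /\ z.2 \in s2.
Proof.
elim: s1 s2 => [|a s1 IH] [|b s2] //=; rewrite !inE => /predU1P[->|/IH[-> ->]].
  by rewrite !eqxx.
by rewrite !orbT.
Qed.

(** Sequences from different blocks branch at the root, in the same direction on both sides, so
    equivalences of the blocks simply add up. *)
Lemma tuple_eqv_cat T r s s' u u' : size s = size s' ->
  tuple_eqv T r (zip s s') -> tuple_eqv T r (zip u u') ->
  precedes s u -> precedes s' u' -> tuple_eqv T r (zip (s ++ u) (s' ++ u')).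
Proof.
move=> ss [H0 H1 H2] [K0 K1 K2] su su'; rewrite zip_cat //.
split=> // [z|z w]; rewrite !mem_cat; first by case/orP; [apply: H1|apply: K1].
have SU z' w' : z' \in zip s s' -> w' \in zip u u' -> same_position z' w'.
  move=> /mem_zip[zs zs'] /mem_zip[wu wu'].
  by apply: same_position_precedes; [apply: su|apply: su'].
case/orP=> zz /orP[] ww; [exact: H2|exact: SU| |exact: K2].
exact/same_positionC/SU.
Qed.

Definition label_eq G (_ : rank) (a a' : seq nat) :=
  [/\ a = a', uniq a & forall x, x \in a -> vertex G x].

Lemma label_eq_system G : system G G (label_eq G).
Proof.
split=> // [r a _ [<- ua va]|f k a _ b [<- ua va] vb nb]; first by split.
exists b; split=> //=; first by rewrite nb.
by move=> x; rewrite inE => /predU1P[->|/va].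
Qed.

(** [label_eq] is the same relation at every rank, so equivalence at [Rank0] gives it at all
    ranks. *)
Definition copy G (v v' : seq (FS_type A t G)) :=
  size v = size v' /\ FS_eqv (label_eq G) Rank0 v v'.

Lemma tuple_eqv_sub T1 T2 r1 r2 zs :
  (forall a b, T1 (om r1) a b -> T2 (om r2) a b) -> tuple_eqv T1 r1 zs -> tuple_eqv T2 r2 zs.
Proof.
move=> H [H0 H1 H2]; split=> [|z /H1|//]; first exact: H.
elim: (rev z.1) (rev z.2) => [|u p IH] [|u' p'] //=; first exact: H.
by move=> [? ? ? ? ?]; split; auto.
Qed.

Lemma copy_eqv G r (v v' : seq (FS_type A t G)) : copy v v' -> FS_eqv (label_eq G) r v v'.
Proof. by move=> [_]; apply: tuple_eqv_sub. Qed.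

Lemma copy_sym G (v v' : seq (FS_type A t G)) : copy v v' -> copy v' v.
Proof.
move=> [s /tuple_eqv_swap]; rewrite map_swap_zip => H; split=> //.
by apply: tuple_eqv_sub H => a b [<-].
Qed.

Lemma copy_trans G (v v' v'' : seq (FS_type A t G)) : copy v v' -> copy v' v'' -> copy v v''.
Proof.
move=> [s H] [s' H']; split; first exact: etrans s'.
by apply: tuple_eqv_comp H H'; rewrite ?size_map // => a b c [<- ua va] [<-].
Qed.

Lemma copy_refl G (v : seq (FS_type A t G)) : copy v v.
Proof.
split=> //; apply/tuple_eqv_zipP => //; split=> // i li.
have [x ->] := FS_tupleP (mem_nth [::] li).
have [+ + + _] := (FS_memP G (sval x)).1 (svalP x); move: (rev _) => p Dp.
have : (parse p).1 <> TagBad by rewrite Dp.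
elim: p {Dp} => [|u p IH] //= nB up vp.
have [nBp upp vpp] := valid_prefix_cons (And3 nB up vp).
by split=> //; apply: IH.
Qed.

Lemma FS_eqv_copy G G' T r (v : seq (FS_type A t G)) (v' v'' : seq (FS_type A t G')) :
  size v = size v' -> FS_eqv T r v v' -> copy v' v'' -> FS_eqv T r v v''.
Proof.
move=> s H [s' H'].
by apply: tuple_eqv_comp H H'; rewrite ?size_map // => a b c Tab [<-].
Qed.

Lemma copy_FS_eqv G G' T r (v v' : seq (FS_type A t G)) (v'' : seq (FS_type A t G')) :
  size v' = size v'' -> copy v v' -> FS_eqv T r v' v'' -> FS_eqv T r v v''.
Proof.
move=> s' [s H] H'.
by apply: tuple_eqv_comp H H'; rewrite ?size_map // => a b c [<-].
Qed.

Lemma FS_eqv_cat G G' T r (v w : seq (FS_type A t G)) (v' w' : seq (FS_type A t G')) :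
  size v = size v' -> FS_eqv T r v v' -> FS_eqv T r w w' ->
  precedes (FS_tuple v) (FS_tuple w) -> precedes (FS_tuple v') (FS_tuple w') ->
  FS_eqv T r (v ++ w) (v' ++ w').
Proof.
move=> s H K P P'; rewrite /FS_eqv /FS_tuple !map_cat.
by apply: tuple_eqv_cat; rewrite ?size_map.
Qed.

Lemma FS_code_size G (x : FS_type A t G) : 0 < size (sval x).
Proof.
have [D _ _ _] := (FS_memP G (sval x)).1 (svalP x).
by rewrite -size_rev; case: (rev _) D.
Qed.

(* The one-letter sequences [:: a] and [:: a'] are not elements of L(G); they only
   force the copy to lie on the required side of a'. *)
Lemma exists_copy_pivot G (v : seq (FS_type A t G)) a a' : col a = 0 -> col a' = 0 ->
  exists2 v', copy v v' & forall x x', (x, x') \in zip (FS_tuple v) (FS_tuple v') ->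
    same_order a (nth 0%R x 0) a' (nth 0%R x' 0).
Proof.
move=> ca ca'.
(* The pivot is placed first. The rank is general because each element of [v] added afterwards costs
   one step. *)
suff H r : exists2 v' : seq (FS_type A t G), size v = size v' & tuple_eqv (label_eq G) r
    (rcons (zip (FS_tuple v) (FS_tuple v')) ([:: a], [:: a'])).
  have [v' s Hv] := H Rank0.
  have S z : z \in zip (FS_tuple v) (FS_tuple v') ->
      z \in rcons (zip (FS_tuple v) (FS_tuple v')) ([:: a], [:: a']).
    by rewrite mem_rcons inE orbC => ->.
  exists v'; first by split=> //; apply: sub_tuple_eqv Hv.
  move=> x x' xx'; have [_ _ H2] := Hv.
  have [|_] := H2 ([:: a], [:: a']) (x, x') _ (S _ xx') 0.
    by rewrite mem_rcons mem_head.
  apply=> //; rewrite ?take0 //; have [/FS_tupleP[y ->] _] := mem_zip xx'.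
  exact: FS_code_size.
elim: v r => [|x v IH] r.
  exists [::] => //; split=> [|z|z w]; rewrite ?inE; first by split.
    by move=> /eqP->; rewrite /rev /=; split=> //; rewrite /labels /parse /parse_step /= ?ca ?ca'.
  by move=> /eqP-> /eqP->; apply: same_position_refl.
have [v' s H] := IH (rank_succ r).
have [x' Fx' Hx'] := tuple_eqv_forth (label_eq_system G) 0 H ((FS_memP _ _).1 (svalP x)).
by exists (exist _ x' ((FS_memP _ _).2 Fx') :: v'); rewrite //= s.
Qed.

Lemma exists_bounds (s : seq rat) :
  exists a b : rat, forall x, x \in s -> (a < x)%R /\ (x < b)%R.
Proof.
have [//|b0 [b [_ bs _]]] := @cut_between s [::].
have [//|a [a0 [_ _ as_]]] := @cut_between [::] s.
exists (a0 - 1)%R, (b0 + 1)%R => x xs; split.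
  by apply: lt_le_trans (as_ x xs); rewrite ltrBlDr ltrDl ltr01.
by apply: le_lt_trans (bs x xs) _; rewrite ltrDl ltr01.
Qed.

Lemma exists_bounds_col0 (s : seq (seq rat)) : exists a b, [/\ col a = 0, col b = 0 &
  forall x, x \in s -> (a < nth 0%R x 0)%R /\ (nth 0%R x 0 < b)%R].
Proof.
have [a [b H]] := exists_bounds [seq nth 0%R x 0 | x <- s].
have aa : (a - 1 < a)%R by rewrite ltrBlDr ltrDl ltr01.
have bb : (b < b + 1)%R by rewrite ltrDl ltr01.
have [a' ca /andP[_ a'a]] := col_dense 0 aa.
have [b' cb /andP[bb' _]] := col_dense 0 bb.
exists a', b'; split=> // x /(map_f (fun x => nth 0%R x 0))/H[ax xb].
by split; [apply: lt_trans ax|apply: lt_trans bb'].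
Qed.

(** A pivot below all first letters of [v] is sent to one above all first letters of [u]. *)
Lemma exists_copy_after G (u v : seq (FS_type A t G)) :
  exists2 v', copy v v' & precedes (FS_tuple u) (FS_tuple v').
Proof.
have [a0 [b [_ cb ub]]] := exists_bounds_col0 (FS_tuple u).
have [a [b0 [ca _ av]]] := exists_bounds_col0 (FS_tuple v).
have [v' vv' H] := exists_copy_pivot v ca cb; exists v' => // x y xu /(nthP [::])[i].
rewrite size_map => iv' <-; have [_ xb] := ub x xu; apply: lt_trans xb _.
have [s _] := vv'.
have /H[+ _] : (nth [::] (FS_tuple v) i, nth [::] (FS_tuple v') i) \in
    zip (FS_tuple v) (FS_tuple v').
  by rewrite -nth_zip ?size_map ?s // mem_nth // size_zip !size_map s minnn.
by move=> /iffLR; apply; have [] := av (nth [::] (FS_tuple v) i); rewrite ?mem_nth ?size_map ?s.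
Qed.

Lemma exists_copy_before G (u v : seq (FS_type A t G)) :
  exists2 v', copy v v' & precedes (FS_tuple v') (FS_tuple u).
Proof.
have [a [b0 [ca _ au]]] := exists_bounds_col0 (FS_tuple u).
have [a0 [b [_ cb vb]]] := exists_bounds_col0 (FS_tuple v).
have [v' vv' H] := exists_copy_pivot v cb ca; exists v' => // y x /(nthP [::])[i].
rewrite size_map => iv' <- xu; have [ax _] := au x xu; apply: lt_trans ax.
have [s _] := vv'.
have /H[_] : (nth [::] (FS_tuple v) i, nth [::] (FS_tuple v') i) \in
    zip (FS_tuple v) (FS_tuple v').
  by rewrite -nth_zip ?size_map ?s // mem_nth // size_zip !size_map s minnn.
by move=> /iffLR; apply; have [] := vb (nth [::] (FS_tuple v) i); rewrite ?mem_nth ?size_map ?s.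
Qed.

(** * Interpretations in L(G) *)

Section Interpretation.
Variable I : interp_formulas.

(** Three choices, of two lengths and a kind of formula, lead from the root to the rank of any
    formula of [I]; the domain formula of length m is reached with n = 0. *)
Definition interp_rank : rank :=
  RankS (fun m => RankS (fun n => RankS (fun k => quantifier_rank
    match k with
    | 0 => dom_formula I (m + n)
    | 1 => sim_formula I m n
    | _ => edge_formula I m n
    end))).

Local Notation dom G := (defined_set (@FS_lt A t G) (dom_formula I)).
Local Notation sim G := (defined_rel (@FS_lt A t G) (sim_formula I)).
Local Notation edg G := (defined_rel (@FS_lt A t G) (edge_formula I)).

Section Transfer.
Variables (G G' : digraph) (T : rank -> seq nat -> seq nat -> Prop).
Hypotheses (sT : system G G' T) (sT' : system G' G (fun r a a' => T r a' a)).

Lemma dom_FS_eqv (v : seq (FS_type A t G)) (v' : seq (FS_type A t G')) :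
  size v = size v' -> FS_eqv T interp_rank v v' -> dom G v <-> dom G' v'.
Proof.
move=> s H.
have {}H := FS_eqv_mono sT 0 (FS_eqv_mono sT 0 (FS_eqv_mono sT (size v) H)).
rewrite /= addn0 in H.
(* [defined_set] takes the formula at [size u], the transfer lemma the one at [n]; eliminating the
   equation identifies them. *)
have domE n (u : n.-tuple (FS_type A t G')) :
    dom G' u <-> sat (@FS_lt A t G') (dom_formula I n) u.
  case: u => u su; rewrite /defined_set /=; case/eqP: (su) => E.
  by case: _ / E su => su; rewrite (_ : in_tuple u = Tuple su) //; apply: val_inj.
have sv' : size v' == size v by rewrite s.
apply: iff_trans (iff_sym (domE _ (Tuple sv'))).
exact: (sat_FS_eqv sT sT' (v := in_tuple v) (v' := Tuple sv') H).
Qed.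

Lemma rel_FS_eqv (phi : forall m n, formula (m + n)) (k : nat)
    (v w : seq (FS_type A t G)) (v' w' : seq (FS_type A t G')) :
    (forall m n, quantifier_rank (phi m n) = quantifier_rank
      match k with
      | 0 => dom_formula I (m + n)
      | 1 => sim_formula I m n
      | _ => edge_formula I m n
      end) ->
    size v = size v' -> size w = size w' -> FS_eqv T interp_rank (v ++ w) (v' ++ w') ->
  defined_rel (@FS_lt A t G) phi v w <-> defined_rel (@FS_lt A t G') phi v' w'.
Proof.
move=> phiE sv sw H.
have {}H := FS_eqv_mono sT k (FS_eqv_mono sT (size w) (FS_eqv_mono sT (size v) H)).
rewrite /= -phiE in H.
have relE m n (u : m.-tuple (FS_type A t G')) (z : n.-tuple (FS_type A t G')) :
    defined_rel (@FS_lt A t G') phi u z <-> sat (@FS_lt A t G') (phi m n) [tuple of u ++ z].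
  case: u => u su; case: z => z sz; rewrite /defined_rel /=.
  case/eqP: (su) => E; case: _ / E su => su.
  case/eqP: (sz) => E; case: _ / E sz => sz.
  by rewrite (_ : [tuple of _] = [tuple of Tuple su ++ Tuple sz]) //; apply: val_inj.
have sv' : size v' == size v by rewrite sv.
have sw' : size w' == size w by rewrite sw.
apply: iff_trans (iff_sym (relE _ _ (Tuple sv') (Tuple sw'))).
exact: (sat_FS_eqv sT sT' (v := [tuple of in_tuple v ++ in_tuple w])
  (v' := [tuple of Tuple sv' ++ Tuple sw']) H).
Qed.

Lemma sim_FS_eqv (v w : seq (FS_type A t G)) (v' w' : seq (FS_type A t G')) :
    size v = size v' -> size w = size w' -> FS_eqv T interp_rank (v ++ w) (v' ++ w') ->
  sim G v w <-> sim G' v' w'.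
Proof. exact: (rel_FS_eqv (k := 1)). Qed.

Lemma edge_FS_eqv (v w : seq (FS_type A t G)) (v' w' : seq (FS_type A t G')) :
    size v = size v' -> size w = size w' -> FS_eqv T interp_rank (v ++ w) (v' ++ w') ->
  edg G v w <-> edg G' v' w'.
Proof. exact: (rel_FS_eqv (k := 2)). Qed.

End Transfer.

(** The isomorphism with the quotient, composed with the class map, so that it is evaluated directly
    on tuples. *)
Definition interpretation_map G (g : seq (FS_type A t G) -> nat) :=
  [/\ forall x, dom G x -> vertex G (g x),
    forall a, vertex G a -> exists2 x, dom G x & g x = a,
    forall x y, dom G x -> dom G y -> sim G x y <-> g x = g y &
    forall x y, dom G x -> dom G y -> edg G x y <-> edge G (g x) (g y)].

Lemma interprets_map G : interprets I (@FS_lt A t G) G ->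
  exists g : seq (FS_type A t G) -> nat, interpretation_map g.
Proof.
move=> [[refl sym trans] compat [f [fv finj fsurj] fE]].
pose cls x := [set y | dom G y /\ sim G x y]%classic.
have clsq x : dom G x -> quot (dom G) (sim G) (cls x) by move=> Dx; exists x.
have simE x y : dom G x -> dom G y -> sim G x y <-> f (cls x) = f (cls y).
  move=> Dx Dy; split=> [xy|E].
    congr f; apply/seteqP; split=> z [Dz H]; split=> //.
      by apply: trans H => //; apply: sym.
    exact: trans H.
  have : cls x = cls y by apply: finj => //; rewrite inE; apply: clsq.
  move/seteqP => [_ /(_ y)[]//]; split=> //; exact: refl.
exists (f \o cls); split=> //=.
- by move=> x Dx; apply/fv/clsq.
- by move=> a /fsurj[_ [x Dx ->] <-]; exists x.
- move=> x y Dx Dy; apply: iff_trans (fE _ _ (clsq x Dx) (clsq y Dy)); split.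
    by move=> E; exists x, y; split=> //; split=> //; apply: refl.
  move=> [x' [y' [[Dx' xx'] [Dy' yy'] E]]].
  by apply/(compat x x' y y').
Qed.

Section Copies.
Variables (G : digraph) (g : seq (FS_type A t G) -> nat).
Hypotheses (woG : well_ordered_graph G) (gP : interpretation_map g).

Let sG := label_eq_system G.

Let sG' : system G G (fun r a a' => label_eq G r a' a).
Proof.
split=> // [r a a' [<- ua va]|f k a a' b [<- ua va] vb nb]; first by split.
exists b; split=> //=; first by rewrite nb.
by move=> x; rewrite inE => /predU1P[->|/va].
Qed.

Lemma dom_copy v v' : copy v v' -> dom G v -> dom G v'.
Proof.
move=> cv; have [s _] := cv.
exact: (dom_FS_eqv sG sG' s (copy_eqv _ cv)).1.
Qed.

(* Independent copies z < z' satisfy the same formulas as any other such pair, and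
   every tuple has independent copies on both sides, so the least value of g on the
   copies of v is attained at all of them. *)
Lemma interp_copy v v' : dom G v -> copy v v' -> g v = g v'.
Proof.
have [_ _ gsim gedge] := gP; have [tot min] := woG; have [gv _ _ _] := gP => Dv.
suff [a Ha] : exists a, forall u, copy v u -> g u = a.
  by move=> vv'; rewrite (Ha _ vv') (Ha _ (copy_refl v)).
have pair z w z' w' : copy v z -> copy v w -> copy v z' -> copy v w' ->
    precedes (FS_tuple z) (FS_tuple w) -> precedes (FS_tuple z') (FS_tuple w') ->
    (g z = g w <-> g z' = g w') /\ (edge G (g z) (g w) <-> edge G (g z') (g w')).
  move=> vz vw vz' vw' zw zw'.
  have czz := copy_trans (copy_sym vz) vz'; have cww := copy_trans (copy_sym vw) vw'.
  have [sz _] := czz; have [sw _] := cww.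
  have H := FS_eqv_cat sz (copy_eqv interp_rank czz) (copy_eqv _ cww) zw zw'.
  have D u (vu : copy v u) := dom_copy vu Dv.
  have S := sim_FS_eqv sG sG' sz sw H; have E := edge_FS_eqv sG sG' sz sw H.
  have [Dz Dw Dz' Dw'] := And4 (D _ vz) (D _ vw) (D _ vz') (D _ vw').
  split; first by rewrite -(gsim z w Dz Dw) -(gsim z' w' Dz' Dw').
  by rewrite -(gedge z w Dz Dw) -(gedge z' w' Dz' Dw').
have [|a [va [z0 vz0 <-] mina]] := min (fun a => exists2 z, copy v z & g z = a).
  by exists (g v); [exact: gv|exists v => //; apply: copy_refl].
have leastz z : copy v z -> ~ edge G (g z) (g z0).
  by move=> vz; apply: mina; [apply/gv/(dom_copy vz)|exists z].
have [z1 c1 z01] := exists_copy_after z0 z0.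
have [y1 cy1 y10] := exists_copy_before z0 z0.
have v1 := copy_trans vz0 c1; have vy1 := copy_trans vz0 cy1.
(* An edge from g z0 to g z1 would transfer to the pair y1, z0 and give a value below the least one;
   the reverse edge does so directly. *)
have E01 : g z0 = g z1.
  have [|//|] := tot (g z0) (g z1) (gv _ (dom_copy vz0 Dv)) (gv _ (dom_copy v1 Dv)).
    by move/(pair _ _ _ _ vy1 vz0 vz0 v1 y10 z01).2/leastz.
  by move/leastz.
exists (g z0) => u vu.
(* [w] lies after both [u] and [z0], so [g] takes the same value at [u], [w] and [z0]. *)
have [w cw uw] := exists_copy_after (u ++ z0) z0.
have vw := copy_trans vz0 cw.
have [uw1 zw1] : precedes (FS_tuple u) (FS_tuple w) /\ precedes (FS_tuple z0) (FS_tuple w).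
  by split=> x y xu yw; apply: uw => //; rewrite /FS_tuple map_cat mem_cat xu ?orbT.
rewrite ((pair _ _ _ _ vu vw vz0 v1 uw1 z01).1.2 E01).
by rewrite ((pair _ _ _ _ vz0 vw vz0 v1 zw1 z01).1.2 E01).
Qed.

End Copies.

(** Vertices represented by equivalent tuples are related. The length of a representing tuple is not
    bounded in advance, so the root of the initial rank branches over it. *)
Lemma interp_isomorphism G G' T (g : seq (FS_type A t G) -> nat)
    (g' : seq (FS_type A t G') -> nat) :
    well_ordered_graph G -> well_ordered_graph G' ->
    system G G' T -> system G' G (fun r a a' => T r a' a) ->
    T (om (RankS (fun n => iter n rank_succ interp_rank))) [::] [::] ->
    interpretation_map g -> interpretation_map g' ->
  exists R, isomorphism_relation G G' R.
Proof.
move=> wG wG' sT sT' T0 gP gP'.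
have [gv gs _ ge] := gP; have [gv' gs' _ ge'] := gP'.
have start n : FS_eqv T (iter n rank_succ interp_rank)
    ([::] : seq (FS_type A t G)) ([::] : seq (FS_type A t G')).
  by apply: (FS_eqv_mono sT n (f := fun n => iter n rank_succ interp_rank)); split.
have forth (v : seq (FS_type A t G)) r : FS_eqv T (iter (size v) rank_succ r)
    ([::] : seq (FS_type A t G)) ([::] : seq (FS_type A t G')) ->
    exists2 v' : seq (FS_type A t G'), size v = size v' & FS_eqv T r v v'.
  elim: v r => [|x v IH] r H; first by exists [::].
  have [|v' s Hv] := IH (rank_succ r); first by rewrite -iterSr.
  by have [x' Hx] := FS_eqv_forth sT 0 x Hv; exists (x' :: v'); rewrite //= s.
have back (v' : seq (FS_type A t G')) r : FS_eqv T (iter (size v') rank_succ r)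
    ([::] : seq (FS_type A t G)) ([::] : seq (FS_type A t G')) ->
    exists2 v : seq (FS_type A t G), size v = size v' & FS_eqv T r v v'.
  elim: v' r => [|x v' IH] r H; first by exists [::].
  have [|v s Hv] := IH (rank_succ r); first by rewrite -iterSr.
  by have [x' Hx] := FS_eqv_back sT' 0 x Hv; exists (x' :: v); rewrite //= s.
exists (fun a a' => exists v v', [/\ dom G v, dom G' v', g v = a /\ g' v' = a',
  size v = size v' & FS_eqv T interp_rank v v']); split.
- move=> a /gs[v Dv <-]; have [v' s H] := forth v _ (start _).
  have Dv' := (dom_FS_eqv sT sT' s H).1 Dv.
  by exists (g' v'); [exact: gv'|exists v, v'].
- move=> a /gs'[v' Dv' <-]; have [v s H] := back v' _ (start _).
  have Dv := (dom_FS_eqv sT sT' s H).2 Dv'.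
  by exists (g v); [exact: gv|exists v, v'].
- move=> _ _ _ _ [v [v' [Dv Dv' [<- <-] s H]]] [w [w' [Dw Dw' [<- <-] sw Hw]]].
  (* Replacing [w] and [w'] by copies after [v] and [v'] keeps the represented vertices, and the two
     separate equivalences then combine into one of the concatenations. *)
  have [u cu vu] := exists_copy_after v w.
  have [u' cu' vu'] := exists_copy_after v' w'.
  rewrite (interp_copy wG gP Dw cu) (interp_copy wG' gP' Dw' cu').
  rewrite -(ge v u Dv (dom_copy cu Dw)) -(ge' v' u' Dv' (dom_copy cu' Dw')).
  have [su _] := cu; have [su' _] := cu'.
  have Hu : FS_eqv T interp_rank u u'.
    by apply: copy_FS_eqv (copy_sym cu) _; [rewrite sw|apply: FS_eqv_copy cu'].
  apply: (edge_FS_eqv sT sT') => //; first by rewrite -su sw.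
  exact: FS_eqv_cat.
Qed.

End Interpretation.
End Lifting.

Theorem mainTheorem1 (A : nat -> set rat) (t : nat -> atype)
    (hA : effective_dense_partition A) (ht : effective_type_list t) :
  ~ exists I : interp_formulas,
      forall G : digraph, interprets I (@FS_lt A t G) G.
Proof.
move=> [I HI]; have [[covA trivA _] denseA _] := hA.
have /choice[col colA] : forall q, exists n, A n q.
  move=> q; have : [set: rat]%classic q by [].
  by rewrite -covA => -[n _ Aq]; exists n.
have colP n q : A n q <-> col q = n.
  split=> [Aq|<-//]; apply: (trivA (col q) n) => //.
  by exists q.
have col_dense n a b : (a < b)%R -> exists2 q, col q = n & (a < q < b)%R.
  by move=> ab; have [q /colP cq aqb] := denseA n a b ab; exists q.
(* The rank depends only on the formulas, so it is available before the two graphs are chosen. *)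
have [G [G' [T [[wG wG'] sT sT' T0]]]] := equivalent_well_ordered_graphs
  (om (RankS (fun n => iter n rank_succ (interp_rank I)))).
have [g gP] := interprets_map (HI G); have [g' gP'] := interprets_map (HI G').
by apply; apply: interp_isomorphism sT sT' T0 gP gP'.
Qed.
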